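(* The ring $\mathbb{W}_0(\mathbb{S})$ is canonically isomorphic to the invariant part of the group ring $\mathbb{Z}[\mathbb{Q}/\mathbb{Z}]$ for the action of the group $\mathrm{Aut}(\mathbb{Q}/\mathbb{Z})=\widehat{\mathbb{Z}}^\times$. The universal additive invariant $\tau:\mathrm{End}(\mathcal{C})\to\mathbb{Z}[\mathbb{Q}/\mathbb{Z}]$ is uniquely determined by the equality of Fourier transforms $$\widehat{\tau(E,T)}(n)=\mathrm{tr}\left(T^n|_{T^\infty(E(1_+))}\right)\qquad \forall n\in\widehat{\mathbb{Z}},\ (E,T)\in \mathrm{End}(\mathcal{C}).$$
   Context: $\Gamma^{\mathrm{op}}$ is the category with objects the pointed sets $k_+=\{0,1,\dots,k\}$ ($k\ge 0$, base point $0$) and morphisms the base-point preserving maps. An $\mathbb{S}$-module is a pointed covariant functor from $\Gamma^{\mathrm{op}}$ to pointed sets; morphisms are natural transformations. $\mathbb{S}$ is the inclusion functor. $\mathbb{S}$-modules form a closed symmetric monoidal category with unit $\mathbb{S}$ for the (Day/Lydakis) smash product $\wedge$. For a finite pointed set $F$, $\mathbb{S}\wedge F$ is the $\mathbb{S}$-module $k_+\mapsto k_+\wedge F$; one has $(\mathbb{S}\wedge F_1)\wedge(\mathbb{S}\wedge F_2)=\mathbb{S}\wedge(F_1\wedge F_2)$. The wedge (join) of $\mathbb{S}$-modules is $(E_1\vee E_2)(k_+)=E_1(k_+)\vee E_2(k_+)$. Let $\mathcal{C}$ be the class of $\mathbb{S}$-modules (isomorphic to one) of the form $\mathbb{S}\wedge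 F$, with $F$ a finite pointed set, and let $\mathrm{End}(\mathcal{C})$ be the class of pairs $(E,T)$ with $E\in\mathcal{C}$ and $T:E\to E$ an endomorphism of $\mathbb{S}$-modules. $T(E)\subset E$ denotes the image $\mathbb{S}$-submodule $k_+\mapsto T(E(k_+))$, on which $T$ acts by restriction. An additive invariant on $\mathcal{C}$ is a map $\chi:\mathrm{End}(\mathcal{C})\to A$ to an abelian group $A$ (depending only on the isomorphism class of the pair $(E,T)$) such that (i) $\chi(E,T)=\chi(T(E),T)$; (ii) $\chi(E_1\vee E_2,T_1\vee T_2)=\chi(E_1,T_1)+\chi(E_2,T_2)$. $\mathbb{W}_0(\mathbb{S})$ is the abelian group which is the target of the universal additive invariant $\tau$ on $\mathcal{C}$ (every additive invariant factors uniquely through it by a group homomorphism). It is a commutative ring with product induced by $(E_1,T_1)\wedge(E_2,T_2):=(E_1\wedge E_2,T_1\wedge T_2)$. Via the isomorphism of the theorem, $\tau$ is viewed as taking values in $\mathbb{Z}[\mathbb{Q}/\mathbb{Z}]$. For $(E,T)\in\mathrm{End}(\mathcal{C})$, $E(1_+)$ is a finite pointed set on which $T$ acts by a pointed map. For a pointed self-map $T:F\to F$ of a finite pointed set, $T^\infty(F)=\bigcap_{n\ge0}T^n(F)$ (the stable value of the decreasing sequence $T^n(F)$), and $\mathrm{tr}(T)$ is the number of fixed points of $T$ minus one (the base point is discarded). $T$ restricts to a permutation of the finite set $T^\infty(F)$, and the powers $T^n|_{T^\infty(F)}$, $n\in\mathbb{N}$, are extended by periodicity to $n\in\widehat{\mathbb{Z}}=\varprojlim\mathbb{Z}/n\mathbb{Z}$.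 $\widehat{\mathbb{Z}}\simeq\mathrm{End}(\mathbb{Q}/\mathbb{Z})$ is identified with the Pontrjagin dual of the discrete group $\mathbb{Q}/\mathbb{Z}$ by the pairing $\langle s,n\rangle=\exp(2\pi i\,ns)$. Let $e:\mathbb{Q}/\mathbb{Z}\to\mathbb{Z}[\mathbb{Q}/\mathbb{Z}]$ be the canonical map; the Fourier transform of $f=\sum_s f_s\,e(s)\in\mathbb{Z}[\mathbb{Q}/\mathbb{Z}]$ is the function $\widehat f(n)=\sum_s f_s\langle s,n\rangle$ on $\widehat{\mathbb{Z}}$. *)

(* Defs.v *)
From HB Require Import structures.
From mathcomp Require Import all_boot all_order all_algebra.
From mathcomp Require Import finmap generic_quotient ring_quotient.
From mathcomp Require Import monalg.
From mathcomp Require Import boolp classical_sets functions cardinality.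
From mathcomp Require Import reals trigo complex.
From Stdlib Require Import Relation_Operators.

Set Implicit Arguments.
Unset Strict Implicit.
Unset Printing Implicit Defensive.

Import Order.TTheory GRing.Theory Num.Theory.

Local Open Scope classical_set_scope.
Local Open Scope ring_scope.
Local Open Scope quotient_scope.

Record ptmap (X Y : pointedType) := PtMap {
  pfun :> X -> Y;
  pfun_pt : pfun point == point }.

HB.instance Definition _ X Y := [isSub for @pfun X Y].

Lemma ptmap_pt X Y (f : ptmap X Y) : f point = point.
Proof. by apply/eqP; apply: pfun_pt. Qed.

Lemma ptmapP X Y (f g : ptmap X Y) : f =1 g -> f = g.
Proof.
case: f g => f pf [g pg] /= /funext fg; subst g.
by congr PtMap; apply: bool_irrelevance.
Qed.

Definition ptid X : ptmap X X := @PtMap X X id (eqxx point).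

Lemma ptcomp_subproof X Y Z (g : ptmap Y Z) (f : ptmap X Y) :
  (g \o f) point == point.
Proof. by rewrite /= !ptmap_pt. Qed.
Definition ptcomp X Y Z (g : ptmap Y Z) (f : ptmap X Y) : ptmap X Z :=
  PtMap (ptcomp_subproof g f).

Definition ptzero X Y : ptmap X Y := @PtMap X Y (fun=> point) (eqxx point).

(* The smash product is (X * Y) / (X \/ Y); every class has exactly one
   representative whose coordinates are both the base point or both different
   from it, and the carrier consists of these representatives. *)
Definition smash (X Y : pointedType) :=
  {p : X * Y | (p.1 == point) == (p.2 == point)}.

Section Smash.
Variables X Y : pointedType.

HB.instance Definition _ := Choice.on (smash X Y).

Lemma smash_pt_subproof :
  ((point, point) : X * Y).1 == point == (((point, point) : X * Y).2 == point).
Proof. by rewrite /= !eqxx. Qed.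
Definition smash_pt : smash X Y := exist _ (point, point) smash_pt_subproof.
HB.instance Definition _ := isPointed.Build (smash X Y) smash_pt.

(* The class of (x, y): the base point as soon as x or y is a base point. *)
Definition spair (x : X) (y : Y) : smash X Y := insubd smash_pt (x, y).

Lemma spair_ptl y : spair point y = point.
Proof.
rewrite /spair /insubd; case: insubP => //= u; rewrite eqxx.
by move=> /eqP/esym/eqP -> uE; apply: val_inj; exact: uE.
Qed.

Lemma spair_ptr x : spair x point = point.
Proof.
rewrite /spair /insubd; case: insubP => //= u; rewrite eqxx.
by move=> /eqP/eqP -> uE; apply: val_inj; exact: uE.
Qed.

Lemma spairE x y : x != point -> y != point -> val (spair x y) = (x, y).
Proof.
by move=> /negbTE x0 /negbTE y0; rewrite /spair val_insubd /= x0 y0.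
Qed.

Lemma spairK (p : smash X Y) : spair (val p).1 (val p).2 = p.
Proof. by rewrite /spair -surjective_pairing valKd. Qed.

Lemma spair_eq_pt x y : spair x y = point -> x = point \/ y = point.
Proof.
case: (eqVneq x point) => [|x0]; first by left.
case: (eqVneq y point) => [|y0]; first by right.
move=> /(congr1 val); rewrite spairE // => -[xE _].
by rewrite xE eqxx in x0.
Qed.

Lemma spair_inj x y x' y' : x != point -> y != point ->
  spair x y = spair x' y' -> x = x' /\ y = y'.
Proof.
move=> x0 y0.
case: (eqVneq x' point) => [->|x0'].
  by rewrite spair_ptl => /spair_eq_pt [] E; rewrite E eqxx in x0 y0.
case: (eqVneq y' point) => [->|y0'].
  by rewrite spair_ptr => /spair_eq_pt [] E; rewrite E eqxx in x0 y0.
by move=> /(congr1 val); rewrite !spairE // => -[].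
Qed.

End Smash.

Lemma smap_subproof X Y X' Y' (f : ptmap X X') (g : ptmap Y Y') :
  (fun p : smash X Y => spair (f (val p).1) (g (val p).2)) point == point.
Proof. by rewrite /= ptmap_pt spair_ptl. Qed.
Definition smap X Y X' Y' (f : ptmap X X') (g : ptmap Y Y') :
  ptmap (smash X Y) (smash X' Y') := PtMap (smap_subproof f g).

Lemma smapE X Y X' Y' (f : ptmap X X') (g : ptmap Y Y') x y :
  smap f g (spair x y) = spair (f x) (g y).
Proof.
case: (eqVneq x point) => [->|x0].
  by rewrite spair_ptl !ptmap_pt spair_ptl.
case: (eqVneq y point) => [->|y0].
  by rewrite spair_ptr !ptmap_pt spair_ptr.
by rewrite /= spairE.
Qed.

Definition wedge (X Y : pointedType) :=
  {p : X * Y | (p.1 == point) || (p.2 == point)}.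

Section Wedge.
Variables X Y : pointedType.

HB.instance Definition _ := Choice.on (wedge X Y).

Lemma wedge_pt_subproof : (((point, point) : X * Y).1 == point) ||
  (((point, point) : X * Y).2 == point).
Proof. by rewrite /= eqxx. Qed.
Definition wedge_pt : wedge X Y := exist _ (point, point) wedge_pt_subproof.
HB.instance Definition _ := isPointed.Build (wedge X Y) wedge_pt.

End Wedge.

Section WedgeMap.
Variables (X Y X' Y' : pointedType) (f : ptmap X X') (g : ptmap Y Y').

Lemma wmap_subproof0 (p : wedge X Y) :
  (f (val p).1 == point) || (g (val p).2 == point).
Proof.
by case: p => p /= /orP[] /eqP ->; rewrite ptmap_pt eqxx ?orbT.
Qed.
Definition wmap_fun (p : wedge X Y) : wedge X' Y' :=
  exist _ (f (val p).1, g (val p).2) (wmap_subproof0 p).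

Lemma wmap_subproof : wmap_fun point == point.
Proof. by apply/eqP/val_inj; rewrite /= !ptmap_pt. Qed.
Definition wmap : ptmap (wedge X Y) (wedge X' Y') := PtMap wmap_subproof.

End WedgeMap.

(* The object k_+ = {0, ..., k} of Gamma^op is 'I_k.+1 with base point 0, and
   the morphisms of Gamma^op are the elements of ptmap 'I_m.+1 'I_n.+1. *)
HB.instance Definition _ k := isPointed.Build 'I_k.+1 ord0.

(* Pointedness of the functor, i.e. preservation of the zero object, is sob0. *)
Record smodule := SModule {
  sob :> nat -> pointedType;
  sfmap : forall m n, ptmap 'I_m.+1 'I_n.+1 -> ptmap (sob m) (sob n);
  sfmap_id : forall n (x : sob n), sfmap (ptid 'I_n.+1) x = x;
  sfmap_comp : forall m n p (g : ptmap 'I_n.+1 'I_p.+1)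
    (f : ptmap 'I_m.+1 'I_n.+1) (x : sob m),
    sfmap (ptcomp g f) x = sfmap g (sfmap f x);
  sob0 : forall x : sob 0%N, x = point }.
Arguments sfmap {s m n} f.

Record smor (E G : smodule) := SMor {
  scomp :> forall k, ptmap (E k) (G k);
  snat : forall m n (f : ptmap 'I_m.+1 'I_n.+1) (x : E m),
    scomp n (sfmap f x) = sfmap f (scomp m x) }.

Definition sid (E : smodule) : smor E E :=
  @SMor E E (fun k => ptid (E k)) (fun _ _ _ _ => erefl).

Definition siso (E G : smodule) :=
  exists phi : smor E G, forall k, bijective (phi k).

Section SSmash.
Variable F : pointedType.

Lemma ssmash_id n (x : smash 'I_n.+1 F) : smap (ptid 'I_n.+1) (ptid F) x = x.
Proof. exact: spairK. Qed.

Lemma ssmash_comp m n p (g : ptmap 'I_n.+1 'I_p.+1) (f : ptmap 'I_m.+1 'I_n.+1)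
  (x : smash 'I_m.+1 F) :
  smap (ptcomp g f) (ptid F) x = smap g (ptid F) (smap f (ptid F) x).
Proof.
by rewrite -[x]spairK !smapE.
Qed.

Lemma ssmash0 (x : smash 'I_1 F) : x = point.
Proof. by rewrite -[x]spairK [(val x).1]ord1 spair_ptl. Qed.

Definition ssmash : smodule :=
  @SModule (fun k => smash 'I_k.+1 F) (fun m n f => smap f (ptid F))
    ssmash_id ssmash_comp ssmash0.

End SSmash.

Definition inC (E : smodule) :=
  exists F : pointedType, finite_set [set: F] /\ siso E (ssmash F).

Section Image.
Variables (E : smodule) (T : smor E E).

Definition simg (k : nat) := {y : E k | `[< exists x, T k x = y >]}.
HB.instance Definition _ k := Choice.on (simg k).

Lemma simg_pt_subproof k : `[< exists x, T k x = point >].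
Proof. by apply/asboolP; exists point; rewrite ptmap_pt. Qed.
HB.instance Definition _ k :=
  isPointed.Build (simg k) (exist _ point (simg_pt_subproof k)).

Lemma simg_map_subproof m n (f : ptmap 'I_m.+1 'I_n.+1) (y : simg m) :
  `[< exists x, T n x = sfmap f (val y) >].
Proof.
by case: y => y /= /asboolP[x <-]; apply/asboolP; exists (sfmap f x); apply: snat.
Qed.
Definition simg_fun m n (f : ptmap 'I_m.+1 'I_n.+1) (y : simg m) : simg n :=
  exist _ (sfmap f (val y)) (simg_map_subproof f y).
Lemma simg_fun_pt m n (f : ptmap 'I_m.+1 'I_n.+1) : simg_fun f point == point.
Proof. by apply/eqP/val_inj; rewrite /= ptmap_pt. Qed.
Definition simg_map m n (f : ptmap 'I_m.+1 'I_n.+1) : ptmap (simg m) (simg n) :=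
  PtMap (simg_fun_pt f).

Lemma simg_id n (x : simg n) : simg_map (ptid 'I_n.+1) x = x.
Proof. by apply: val_inj; apply: sfmap_id. Qed.
Lemma simg_comp m n p (g : ptmap 'I_n.+1 'I_p.+1) (f : ptmap 'I_m.+1 'I_n.+1)
  (x : simg m) : simg_map (ptcomp g f) x = simg_map g (simg_map f x).
Proof. by apply: val_inj; apply: sfmap_comp. Qed.
Lemma simg0 (x : simg 0%N) : x = point.
Proof. by apply: val_inj; rewrite [LHS]sob0 [RHS]sob0. Qed.

Definition simage : smodule := SModule simg_id simg_comp simg0.

Lemma srestr_subproof0 k (y : simg k) : `[< exists x, T k x = T k (val y) >].
Proof. by apply/asboolP; exists (val y). Qed.
Definition srestr_fun k (y : simg k) : simg k :=
  exist _ (T k (val y)) (srestr_subproof0 y).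
Lemma srestr_fun_pt k : srestr_fun (k := k) point == point.
Proof. by apply/eqP/val_inj; rewrite /= ptmap_pt. Qed.
Definition srestr_map k : ptmap (simage k) (simage k) := PtMap (srestr_fun_pt k).
Lemma srestr_nat m n (f : ptmap 'I_m.+1 'I_n.+1) (x : simage m) :
  srestr_map n (sfmap f x) = sfmap f (srestr_map m x).
Proof. by apply: val_inj; apply: snat. Qed.
Definition srestr : smor simage simage := SMor srestr_nat.

End Image.

Section SWedge.
Variables E1 E2 : smodule.

Lemma swedge_id n (x : wedge (E1 n) (E2 n)) :
  wmap (sfmap (ptid 'I_n.+1)) (sfmap (ptid 'I_n.+1)) x = x.
Proof. by apply: val_inj => /=; rewrite !sfmap_id; case: x => -[]. Qed.
Lemma swedge_comp m n p (g : ptmap 'I_n.+1 'I_p.+1) (f : ptmap 'I_m.+1 'I_n.+1)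
  (x : wedge (E1 m) (E2 m)) :
  wmap (sfmap (ptcomp g f)) (sfmap (ptcomp g f)) x =
  wmap (sfmap g) (sfmap g) (wmap (sfmap f) (sfmap f) x).
Proof. by apply: val_inj => /=; rewrite !sfmap_comp. Qed.
Lemma swedge0 (x : wedge (E1 0%N) (E2 0%N)) : x = point.
Proof.
by apply: val_inj; case: x => -[x y] /= _; rewrite (sob0 x) (sob0 y).
Qed.

Definition swedge : smodule :=
  @SModule (fun k => wedge (E1 k) (E2 k)) (fun m n f => wmap (sfmap f) (sfmap f))
    swedge_id swedge_comp swedge0.

End SWedge.

Section SWedgeMap.
Variables (E1 E2 : smodule) (T1 : smor E1 E1) (T2 : smor E2 E2).

Definition swmap_map k : ptmap (swedge E1 E2 k) (swedge E1 E2 k) :=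
  wmap (T1 k) (T2 k).
Lemma swmap_nat m n (f : ptmap 'I_m.+1 'I_n.+1) (x : swedge E1 E2 m) :
  swmap_map n (sfmap f x) = sfmap f (swmap_map m x).
Proof. by apply: val_inj => /=; rewrite !snat. Qed.
Definition swmap : smor (swedge E1 E2) (swedge E1 E2) :=
  SMor swmap_nat.

End SWedgeMap.

(* (E1 /\ E2)(k_+) is the colimit, in pointed sets, of E1(m_+) /\ E2(n_+) over
   the category of all f : m_+ /\ n_+ -> k_+: triples (f, x, y), with x in
   E1(m_+) and y in E2(n_+), modulo the relation generated by day_step. *)
Section Day.
Variables E1 E2 : smodule.

Record day_gen (k : nat) := DayGen {
  day_m : nat;
  day_n : nat;
  day_f : ptmap (smash 'I_day_m.+1 'I_day_n.+1) 'I_k.+1;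
  day_x : E1 day_m;
  day_y : E2 day_n }.

HB.instance Definition _ k := gen_eqMixin (day_gen k).
HB.instance Definition _ k := gen_choiceMixin (day_gen k).

Definition day_base k : day_gen k :=
  DayGen (ptzero (smash 'I_1 'I_1) 'I_k.+1) point point.

Inductive day_step k : day_gen k -> day_gen k -> Prop :=
| day_move m n m' n' (a : ptmap 'I_m.+1 'I_m'.+1) (b : ptmap 'I_n.+1 'I_n'.+1)
    (f : ptmap (smash 'I_m'.+1 'I_n'.+1) 'I_k.+1) (x : E1 m) (y : E2 n) :
    day_step (DayGen (ptcomp f (smap a b)) x y)
             (DayGen f (sfmap a x) (sfmap b y))
| day_collapse m n (f : ptmap (smash 'I_m.+1 'I_n.+1) 'I_k.+1)
    (x : E1 m) (y : E2 n) :
    x = point \/ y = point -> day_step (DayGen f x y) (day_base k).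

Definition day_eq k (t u : day_gen k) : bool :=
  `[< clos_refl_sym_trans _ (@day_step k) t u >].

Lemma day_eq_equiv k : equiv_class_of (@day_eq k).
Proof.
split=> [t|t u|u t v].
- by apply/asboolP; apply: rst_refl.
- by apply/asboolP/asboolP; apply: rst_sym.
- by move=> /asboolP tu /asboolP uv; apply/asboolP; apply: rst_trans uv.
Qed.
Canonical day_equiv k := EquivRelPack (@day_eq_equiv k).

Definition day (k : nat) := {eq_quot day_equiv k}.
HB.instance Definition _ k := Choice.on (day k).
HB.instance Definition _ k := EqQuotient.on (day k).
HB.instance Definition _ k := isPointed.Build (day k) (\pi_(day k) (day_base k)).

Lemma day_piP k (t u : day_gen k) :
  clos_refl_sym_trans _ (@day_step k) t u <-> \pi_(day k) t = \pi_(day k) u.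
Proof.
split=> [tu|/eqmodP/asboolP//]; by apply/eqmodP/asboolP.
Qed.

Definition day_post k l (g : ptmap 'I_k.+1 'I_l.+1) (t : day_gen k) : day_gen l :=
  DayGen (ptcomp g (day_f t)) (day_x t) (day_y t).

Lemma day_step_post k l (g : ptmap 'I_k.+1 'I_l.+1) (t u : day_gen k) :
  day_step t u ->
  clos_refl_sym_trans _ (@day_step l) (day_post g t) (day_post g u).
Proof.
case=> [m n m' n' a b f x y|m n f x y xy].
  apply: rst_step; rewrite /day_post /=.
  have -> : ptcomp g (ptcomp f (smap a b)) = ptcomp (ptcomp g f) (smap a b).
    exact: ptmapP.
  exact: day_move.
apply: rst_step; rewrite /day_post /=.
have -> : ptcomp g (ptzero (smash 'I_1 'I_1) 'I_k.+1) =
          ptzero (smash 'I_1 'I_1) 'I_l.+1.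
  by apply: ptmapP => z /=; rewrite ptmap_pt.
exact: day_collapse.
Qed.

Lemma rst_map A B (r : A -> A -> Prop) (s : B -> B -> Prop) (h : A -> B) :
  (forall x y, r x y -> clos_refl_sym_trans _ s (h x) (h y)) ->
  forall x y, clos_refl_sym_trans _ r x y -> clos_refl_sym_trans _ s (h x) (h y).
Proof.
move=> hrs x y; elim=> {x y} [x y /hrs//|x|x y _|x y z _ xy _].
- exact: rst_refl.
- exact: rst_sym.
- exact: rst_trans xy.
Qed.

Definition day_fun k l (g : ptmap 'I_k.+1 'I_l.+1) (q : day k) : day l :=
  \pi_(day l) (day_post g (repr q)).

Lemma day_funE k l (g : ptmap 'I_k.+1 'I_l.+1) (t : day_gen k) :
  day_fun g (\pi_(day k) t) = \pi_(day l) (day_post g t).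
Proof.
apply/day_piP; apply: rst_map (@day_step_post _ _ g) _ _ _.
by apply/day_piP; rewrite reprK.
Qed.

Lemma day_fun_pt k l (g : ptmap 'I_k.+1 'I_l.+1) : day_fun g point == point.
Proof.
apply/eqP; rewrite [LHS]day_funE; apply/day_piP; apply: rst_step.
by apply: day_collapse; left.
Qed.
Definition day_map k l (g : ptmap 'I_k.+1 'I_l.+1) : ptmap (day k) (day l) :=
  PtMap (day_fun_pt g).

Lemma day_id k (q : day k) : day_map (ptid 'I_k.+1) q = q.
Proof.
rewrite -[q]reprK [LHS]day_funE; case: (repr q) => m n f x y.
by congr (\pi_(day k) (DayGen _ _ _)); apply: ptmapP.
Qed.
Lemma day_comp k l p (g : ptmap 'I_l.+1 'I_p.+1) (f : ptmap 'I_k.+1 'I_l.+1)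
  (q : day k) : day_map (ptcomp g f) q = day_map g (day_map f q).
Proof.
rewrite -[q]reprK [LHS]day_funE; case: (repr q) => m n h x y.
rewrite [X in _ = day_map g X]day_funE [RHS]day_funE.
by congr (\pi_(day p) (DayGen _ _ _)); apply: ptmapP.
Qed.
Lemma day_ob0 (q : day 0%N) : q = point.
Proof.
rewrite -[q]reprK; case: (repr q) => m n f x y.
have -> : f = ptcomp (ptzero (smash 'I_1 'I_1) 'I_1)
                    (smap (ptzero 'I_m.+1 'I_1) (ptzero 'I_n.+1 'I_1)).
  by apply: ptmapP => z; rewrite [LHS]ord1 [RHS]ord1.
apply/day_piP; apply: rst_trans (rst_step _ _ _ _ (day_move _ _ _ _ _)) _.
by apply: rst_step; apply: day_collapse; left; apply: sob0.
Qed.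

Definition sday : smodule := SModule day_id day_comp day_ob0.

End Day.

Section DayMap.
Variables (E1 E2 : smodule) (T1 : smor E1 E1) (T2 : smor E2 E2).

Definition day_tens k (t : day_gen E1 E2 k) : day_gen E1 E2 k :=
  DayGen (day_f t) (T1 _ (day_x t)) (T2 _ (day_y t)).

Lemma day_step_tens k (t u : day_gen E1 E2 k) : day_step t u ->
  clos_refl_sym_trans _ (@day_step E1 E2 k) (day_tens t) (day_tens u).
Proof.
case=> [m n m' n' a b f x y|m n f x y xy]; apply: rst_step; rewrite /day_tens /=.
  by rewrite !snat; apply: day_move.
rewrite !ptmap_pt; apply: day_collapse.
by case: xy => ->; rewrite ptmap_pt; [left|right].
Qed.

Definition day_tens_fun k (q : day E1 E2 k) : day E1 E2 k :=
  \pi_(day E1 E2 k) (day_tens (repr q)).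

Lemma day_tensE k (t : day_gen E1 E2 k) :
  day_tens_fun (\pi_(day E1 E2 k) t) = \pi_(day E1 E2 k) (day_tens t).
Proof.
apply/day_piP; apply: rst_map (@day_step_tens _) _ _ _.
by apply/day_piP; rewrite reprK.
Qed.

Lemma day_tens_pt k : day_tens_fun (k := k) point == point.
Proof.
apply/eqP; rewrite [LHS]day_tensE; apply/day_piP; apply: rst_step.
by apply: day_collapse; left; rewrite ptmap_pt.
Qed.
Definition day_tens_map k : ptmap (sday E1 E2 k) (sday E1 E2 k) :=
  PtMap (day_tens_pt k).
Lemma sday_nat m n (f : ptmap 'I_m.+1 'I_n.+1) (x : sday E1 E2 m) :
  day_tens_map n (sfmap f x) = sfmap f (day_tens_map m x).
Proof.
rewrite -[x]reprK [X in day_tens_map _ X]day_funE [LHS]day_tensE.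
by rewrite [X in sfmap f X]day_tensE [RHS]day_funE.
Qed.
Definition sday_map : smor (sday E1 E2) (sday E1 E2) := SMor sday_nat.

End DayMap.

Lemma inj_surj_bij (X Y : Type) (f : X -> Y) :
  injective f -> (forall y, exists x, f x = y) -> bijective f.
Proof. by move=> fI /choice[g fg]; exists g => // x; apply: fI. Qed.

Lemma finite_setT_inj (X Y : Type) (f : X -> Y) :
  injective f -> finite_set [set: Y] -> finite_set [set: X].
Proof.
move=> fI; rewrite -(preimage_setT f).
by apply: finite_preimage => x y _ _; apply: fI.
Qed.

Lemma finite_setT_pair (X Y : Type) :
  finite_set [set: X] -> finite_set [set: Y] -> finite_set [set: X * Y].
Proof. by move=> fX fY; rewrite -setXTT; apply: finite_setX. Qed.

Lemma finite_smash (X Y : pointedType) :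
  finite_set [set: X] -> finite_set [set: Y] -> finite_set [set: smash X Y].
Proof.
move=> fX fY; apply: (finite_setT_inj (f := @proj1_sig _ _)) => [p q|].
  exact: val_inj.
exact: finite_setT_pair.
Qed.

Definition kpick_fun k (i : 'I_k.+1) (j : 'I_2) : 'I_k.+1 :=
  if j == ord0 then ord0 else i.
Definition kpick k (i : 'I_k.+1) : ptmap 'I_2 'I_k.+1 :=
  @PtMap _ _ (kpick_fun i) (eqxx ord0).

Lemma kpick_comp k l (f : ptmap 'I_k.+1 'I_l.+1) (i : 'I_k.+1) :
  ptcomp f (kpick i) = kpick (f i).
Proof.
by apply: ptmapP => j /=; rewrite /kpick_fun; case: eqP => // _; apply: ptmap_pt.
Qed.

Lemma sfmap_zero (E : smodule) m n (x : E m) :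
  sfmap (ptzero 'I_m.+1 'I_n.+1) x = point.
Proof.
have -> : ptzero 'I_m.+1 'I_n.+1 =
  ptcomp (ptzero 'I_1 'I_n.+1) (ptzero 'I_m.+1 'I_1) by exact: ptmapP.
by rewrite sfmap_comp [X in sfmap _ X]sob0 ptmap_pt.
Qed.

Lemma smash2P (F : pointedType) (p : smash 'I_2 F) :
  exists y, p = spair ord_max y.
Proof.
rewrite -[p]spairK; move: (val p).1 (val p).2 => i y.
case: (eqVneq i ord0) => [->|i0].
  by exists point; rewrite spair_ptl spair_ptr.
exists y; congr spair; apply: val_inj.
by case: i i0 => -[|[]].
Qed.

Lemma ssmash_kpick (E : smodule) (F : pointedType) (phi : smor E (ssmash F))
    k (i : 'I_k.+1) (x : E 1%N) y :
  phi 1%N x = spair (ord_max : 'I_2) y ->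
  phi k (sfmap (kpick i) x) = spair i y.
Proof.
move=> xy; rewrite snat xy [LHS](smapE (kpick i) (ptid F)).
by congr spair.
Qed.

Definition Ccrit (E : smodule) :=
  [/\ finite_set [set: E 1%N],
      forall k (e : E k), exists (i : 'I_k.+1) (x : E 1%N), sfmap (kpick i) x = e
    & forall k (i i' : 'I_k.+1) (x x' : E 1%N), i != point -> x != point ->
        sfmap (kpick i) x = sfmap (kpick i') x' -> i = i' /\ x = x'].

Lemma inC_crit E : inC E -> Ccrit E.
Proof.
move=> [F [finF [phi phiB]]]; have phiI k := bij_inj (phiB k).
have phiS k y : exists x, phi k x = y.
  by case: (phiB k) => g _ gK; exists (g y); apply: gK.
split.
- apply: (finite_setT_inj (f := phi 1%N)); first exact: phiI.
  by apply: finite_smash => //; apply: finite_finset.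
- move=> k e; have [x xE] := phiS 1%N (spair (ord_max : 'I_2) (val (phi k e)).2).
  exists (val (phi k e)).1, x; apply: (phiI).
  by rewrite (ssmash_kpick _ xE) spairK.
- move=> k i i' x x' i0 x0.
  have [y xy] := smash2P (phi 1%N x); have [y' xy'] := smash2P (phi 1%N x').
  have y0 : y != point.
    apply: contra x0 => /eqP yE; apply/eqP/(phiI).
    by rewrite xy yE spair_ptr ptmap_pt.
  move=> /(congr1 (phi k)); rewrite (ssmash_kpick _ xy) (ssmash_kpick _ xy').
  move=> /(spair_inj i0 y0)[ii' yy']; split=> //.
  by apply: (phiI); rewrite xy yy' xy'.
Qed.

Lemma crit_inC E : Ccrit E -> inC E.
Proof.
move=> [finE surj inj]; exists (E 1%N); split=> //.
pose asm k (p : smash 'I_k.+1 (E 1%N)) : E k := sfmap (kpick (val p).1) (val p).2.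
have asmE k (i : 'I_k.+1) (x : E 1%N) : asm k (spair i x) = sfmap (kpick i) x.
  have pick0 : kpick ord0 = ptzero 'I_2 'I_k.+1.
    by apply: ptmapP => j /=; rewrite /kpick_fun if_same.
  case: (eqVneq i point) => [->|i0].
    by rewrite spair_ptl /asm /= ptmap_pt [in RHS]pick0 sfmap_zero.
  case: (eqVneq x point) => [->|x0].
    by rewrite spair_ptr /asm /= !ptmap_pt.
  by rewrite /asm spairE.
have asm_nat m n (f : ptmap 'I_m.+1 'I_n.+1) p :
    asm n (smap f (ptid (E 1%N)) p) = sfmap f (asm m p).
  by rewrite -[p]spairK smapE !asmE -sfmap_comp kpick_comp.
have asm_pt k p : asm k p = point -> p = point.
  move=> p0; case: (eqVneq p point) => // pn0.
  move: p0; rewrite -[p]spairK asmE.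
  have [i0|i0] := eqVneq (val p).1 point; first by rewrite i0 spair_ptl.
  have [x0|x0] := eqVneq (val p).2 point; first by rewrite x0 spair_ptr.
  rewrite -[X in _ = X -> _](ptmap_pt (sfmap (kpick (point : 'I_k.+1)))).
  by move=> /(inj _ _ _ _ _ i0 x0)[E0 _]; rewrite E0 eqxx in i0.
have asmI k : injective (asm k).
  move=> p q pq.
  have [p0|p0] := eqVneq p point.
    rewrite p0; apply/esym/asm_pt; rewrite -pq p0.
    by rewrite /asm /= ptmap_pt.
  move: pq p0; rewrite -[p]spairK -[q]spairK !asmE => pq p0.
  have i0 : (val p).1 != point.
    by apply: contra p0 => /eqP ->; rewrite spair_ptl.
  have x0 : (val p).2 != point.
    by apply: contra p0 => /eqP ->; rewrite spair_ptr.
  by have [-> ->] := inj _ _ _ _ _ i0 x0 pq.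
have asmS k (e : E k) : {p | asm k p = e}.
  apply: cid; have [i [x <-]] := surj k e; by exists (spair i x).
pose g k (e : E k) := projT1 (asmS k e).
have gE k : cancel (g k) (asm k) by move=> e; apply: (projT2 (asmS k e)).
have g_pt k : g k point == point.
  by apply/eqP/asm_pt; rewrite gE.
have g_nat m n (f : ptmap 'I_m.+1 'I_n.+1) (x : E m) :
    g n (sfmap f x) = smap f (ptid (E 1%N)) (g m x).
  by apply: (asmI); rewrite asm_nat !gE.
exists (@SMor E (ssmash (E 1%N)) (fun k => PtMap (g_pt k)) g_nat) => k /=.
by exists (asm k) => [|p]; [apply: gE | apply: (asmI); rewrite gE].
Qed.

Lemma inC_ssmash (F : pointedType) : finite_set [set: F] -> inC (ssmash F).
Proof. by move=> finF; exists F; split=> //; exists (sid _) => k; exists id. Qed.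

Lemma inC_image E (T : smor E E) : inC E -> inC (simage T).
Proof.
move=> /inC_crit[finE surj inj]; apply: crit_inC; split.
- by apply: (finite_setT_inj (f := @proj1_sig _ _) _ finE) => p q; apply: val_inj.
- move=> k [y yT]; have /asboolP[x xy] := yT.
  have [i [x1 xE]] := surj k x.
  have x1T : `[< exists x, T 1%N x = T 1%N x1 >] by apply/asboolP; exists x1.
  exists i, (exist _ (T 1%N x1) x1T); apply: val_inj => /=.
  by rewrite -snat xE.
- move=> k i i' x x' i0 x0 /(congr1 val) /= xx'.
  have x0' : val x != point by [].
  have [ii' vv'] := inj _ _ _ _ _ i0 x0' xx'.
  by split=> //; apply: val_inj.
Qed.

Lemma inC_wedge E1 E2 : inC E1 -> inC E2 -> inC (swedge E1 E2).
Proof.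
move=> /inC_crit[fin1 surj1 inj1] /inC_crit[fin2 surj2 inj2].
apply: crit_inC; split.
- apply: (finite_setT_inj (f := @proj1_sig _ _)) => [p q|]; first exact: val_inj.
  exact: finite_setT_pair.
- move=> k [[x y] /= xy]; have [y0|y0] := eqVneq y point.
    have [i [x1 xE]] := surj1 k x.
    have w : (((x1, point) : E1 1%N * E2 1%N).1 == point) ||
             (((x1, point) : E1 1%N * E2 1%N).2 == point).
      by rewrite /= eqxx orbT.
    exists i.
    exists (exist (fun p : E1 1%N * E2 1%N => (p.1 == point) || (p.2 == point))
      (x1, point) w); apply: val_inj => /=.
    by rewrite xE ptmap_pt y0.
  have x0 : x = point by have := xy; rewrite (negbTE y0) orbF => /eqP.
  have [i [y1 yE]] := surj2 k y.
  have w : (((point, y1) : E1 1%N * E2 1%N).1 == point) ||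
           (((point, y1) : E1 1%N * E2 1%N).2 == point).
    by rewrite /= eqxx.
  exists i.
  exists (exist (fun p : E1 1%N * E2 1%N => (p.1 == point) || (p.2 == point))
    (point, y1) w); apply: val_inj => /=.
  by rewrite yE ptmap_pt x0.
- move=> k i i' [[x y] /= xy] [[x' y'] /= xy'] i0 w0 /(congr1 val) /= [xx' yy'].
  have [x0|x0] := eqVneq x point.
    have y0 : y != point.
      by apply: contra w0 => /eqP y0; apply/eqP/val_inj; rewrite /= x0 y0.
    have [ii' y2] := inj2 _ _ _ _ _ i0 y0 yy'; split=> //; apply: val_inj => /=.
    have x0' : x' = point.
      by have := xy'; rewrite -y2 (negbTE y0) orbF => /eqP.
    by rewrite y2 x0 x0'.
  have [ii' x2] := inj1 _ _ _ _ _ i0 x0 xx'; split=> //; apply: val_inj => /=.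
  have y0 : y = point by have := xy; rewrite (negbTE x0) => /eqP.
  have y0' : y' = point by have := xy'; rewrite -x2 (negbTE x0) => /eqP.
  by rewrite x2 y0 y0'.
Qed.

Section DayClosure.
Variables (E1 E2 : smodule) (F1 F2 : pointedType).
Variables (phi1 : smor E1 (ssmash F1)) (phi2 : smor E2 (ssmash F2)).
Hypotheses (phi1B : forall k, bijective (phi1 k)).
Hypotheses (phi2B : forall k, bijective (phi2 k)).

Let psi_gen k (t : day_gen E1 E2 k) : smash 'I_k.+1 (smash F1 F2) :=
  let p := phi1 _ (day_x t) in let q := phi2 _ (day_y t) in
  spair (day_f t (spair (val p).1 (val q).1)) (spair (val p).2 (val q).2).

Let psi_genE k m n (f : ptmap (smash 'I_m.+1 'I_n.+1) 'I_k.+1)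
    (x : E1 m) (y : E2 n) i j u v :
  phi1 m x = spair i u -> phi2 n y = spair j v ->
  psi_gen (DayGen f x y) = spair (f (spair i j)) (spair u v).
Proof.
move=> xE yE.
have -> : psi_gen (DayGen f x y) =
  spair (f (spair (val (phi1 m x)).1 (val (phi2 n y)).1))
        (spair (val (phi1 m x)).2 (val (phi2 n y)).2) by [].
rewrite {}xE {}yE.
have pt1 X Y : (val (point : smash X Y)).1 = point by [].
have pt2 X Y : (val (point : smash X Y)).2 = point by [].
have [->|i0] := eqVneq i point.
  by rewrite !(spair_ptl, spair_ptr, ptmap_pt, pt1, pt2).
have [->|u0] := eqVneq u point.
  by rewrite !(spair_ptl, spair_ptr, ptmap_pt, pt1, pt2).
have [->|j0] := eqVneq j point.
  by rewrite !(spair_ptl, spair_ptr, ptmap_pt, pt1, pt2).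
have [->|v0] := eqVneq v point.
  by rewrite !(spair_ptl, spair_ptr, ptmap_pt, pt1, pt2).
by rewrite !spairE.
Qed.

Let psi_step k (t u : day_gen E1 E2 k) : day_step t u -> psi_gen t = psi_gen u.
Proof.
case=> [m n m' n' a b f x y|m n f x y xy].
  have xE := esym (spairK (phi1 _ x)); have yE := esym (spairK (phi2 _ y)).
  rewrite (psi_genE _ xE yE).
  have xE' : phi1 _ (sfmap a x) = spair (a (val (phi1 _ x)).1) (val (phi1 _ x)).2.
    by rewrite snat [in LHS]xE [LHS](smapE a (ptid F1)).
  have yE' : phi2 _ (sfmap b y) = spair (b (val (phi2 _ y)).1) (val (phi2 _ y)).2.
    by rewrite snat [in LHS]yE [LHS](smapE b (ptid F2)).
  rewrite (psi_genE _ xE' yE'); congr spair.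
  by rewrite -smapE.
rewrite [RHS]spair_ptl /psi_gen /=.
by case: xy => ->; rewrite ptmap_pt /= ?spair_ptl ?spair_ptr.
Qed.

Let psi_fun k (q : day E1 E2 k) : smash 'I_k.+1 (smash F1 F2) :=
  psi_gen (repr q).

Let psi_funE k (t : day_gen E1 E2 k) :
  psi_fun (\pi_(day E1 E2 k) t) = psi_gen t.
Proof.
have H t1 t2 : clos_refl_sym_trans _ (@day_step E1 E2 k) t1 t2 ->
    psi_gen t1 = psi_gen t2.
  by elim=> {t1 t2} [x y /psi_step//|//|x y _ ->//|x y z _ -> _ ->].
by apply: H; apply/day_piP; rewrite reprK.
Qed.

Let psi_pt k : psi_fun (k := k) point == point.
Proof. by apply/eqP; rewrite [LHS]psi_funE [LHS]spair_ptl. Qed.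

Let psi_map k : ptmap (sday E1 E2 k) (ssmash (smash F1 F2) k) :=
  PtMap (psi_pt k).

Let psi_nat m n (f : ptmap 'I_m.+1 'I_n.+1) (x : sday E1 E2 m) :
  psi_map n (sfmap f x) = sfmap f (psi_map m x).
Proof.
rewrite -[x]reprK [X in psi_map _ X]day_funE [LHS]psi_funE.
rewrite [X in sfmap f X]psi_funE.
by rewrite [RHS](smapE f (ptid (smash F1 F2))).
Qed.

Let psi : smor (sday E1 E2) (ssmash (smash F1 F2)) := SMor psi_nat.

Let bump_fun k (l : 'I_k.+1) (p : smash 'I_2 'I_2) : 'I_k.+1 :=
  if p == point then point else l.
Let bump_pt k (l : 'I_k.+1) : bump_fun l point == point.
Proof. by rewrite /bump_fun eqxx. Qed.
Let kbump k (l : 'I_k.+1) : ptmap (smash 'I_2 'I_2) 'I_k.+1 := PtMap (bump_pt l).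

Let kbumpE k m n (f : ptmap (smash 'I_m.+1 'I_n.+1) 'I_k.+1) i j :
  ptcomp f (smap (kpick i) (kpick j)) = kbump (f (spair i j)).
Proof.
apply: ptmapP => p /=.
rewrite -[p]spairK; move: (val p).1 (val p).2 => a b.
rewrite /bump_fun.
have [->|a0] := eqVneq a point.
  by rewrite !spair_ptl eqxx /= ptmap_pt.
have [->|b0] := eqVneq b point.
  by rewrite !spair_ptr eqxx /= ptmap_pt.
have /negbTE -> : spair a b != point.
  by apply/eqP => /spair_eq_pt[] E; rewrite E eqxx in a0 b0.
rewrite spairE //= /kpick_fun.
by rewrite -[ord0]/(point : 'I_2) (negbTE a0) (negbTE b0).
Qed.

Let phi1S u : {x | phi1 1%N x = spair (ord_max : 'I_2) u}.
Proof. by apply: cid; case: (phi1B 1%N) => g _ gK; exists (g (spair ord_max u)). Qed.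
Let phi2S u : {x | phi2 1%N x = spair (ord_max : 'I_2) u}.
Proof. by apply: cid; case: (phi2B 1%N) => g _ gK; exists (g (spair ord_max u)). Qed.

Let nf k (l : 'I_k.+1) u v : day E1 E2 k :=
  \pi_(day E1 E2 k) (DayGen (kbump l) (projT1 (phi1S u)) (projT1 (phi2S v))).

Let psi_nf k (l : 'I_k.+1) u v : psi k (nf l u v) = spair l (spair u v).
Proof.
rewrite [LHS]psi_funE (psi_genE _ (projT2 (phi1S u)) (projT2 (phi2S v))).
congr spair; rewrite /= /bump_fun ifN //.
by apply/eqP => /spair_eq_pt[].
Qed.

Let nfP k (q : day E1 E2 k) : exists l u v, q = nf l u v.
Proof.
rewrite -[q]reprK; case: (repr q) => m n f x y.
set i := (val (phi1 _ x)).1; set u := (val (phi1 _ x)).2.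
set j := (val (phi2 _ y)).1; set v := (val (phi2 _ y)).2.
exists (f (spair i j)), u, v.
have -> : x = sfmap (kpick i) (projT1 (phi1S u)).
  apply: (bij_inj (phi1B m)); rewrite (ssmash_kpick _ (projT2 (phi1S u))).
  by rewrite spairK.
have -> : y = sfmap (kpick j) (projT1 (phi2S v)).
  apply: (bij_inj (phi2B n)); rewrite (ssmash_kpick _ (projT2 (phi2S v))).
  by rewrite spairK.
rewrite /nf -kbumpE; apply/day_piP/rst_sym/rst_step; exact: day_move.
Qed.

Let phi1_pt x : phi1 1%N x = spair ord_max point -> x = point.
Proof.
by move=> E; apply: (bij_inj (phi1B 1%N)); rewrite E spair_ptr ptmap_pt.
Qed.
Let phi2_pt x : phi2 1%N x = spair ord_max point -> x = point.
Proof.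
by move=> E; apply: (bij_inj (phi2B 1%N)); rewrite E spair_ptr ptmap_pt.
Qed.

Let nf_pt k (l : 'I_k.+1) u v : [\/ l = point, u = point | v = point] ->
  nf l u v = point.
Proof.
rewrite /nf => luv; apply/day_piP.
case: luv => [->|u0|v0]; last 2 first.
- apply: rst_step; apply: day_collapse; left; apply: phi1_pt.
  by rewrite (projT2 (phi1S u)) u0.
- apply: rst_step; apply: day_collapse; right; apply: phi2_pt.
  by rewrite (projT2 (phi2S v)) v0.
have -> : kbump (point : 'I_k.+1) =
    ptcomp (ptzero (smash 'I_1 'I_1) 'I_k.+1)
           (smap (ptzero 'I_2 'I_1) (ptzero 'I_2 'I_1)).
  by apply: ptmapP => p /=; rewrite /bump_fun if_same.
apply: rst_trans (rst_step _ _ _ _ (day_move _ _ _ _ _)) _.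
by apply: rst_step; apply: day_collapse; left; apply: sob0.
Qed.

Let psi_inj k : injective (psi k).
Proof.
move=> q q'; have [l [u [v ->]]] := nfP q; have [l' [u' [v' ->]]] := nfP q'.
rewrite !psi_nf => luv.
have pt0 (a : 'I_k.+1) b c : spair a (spair b c) = point ->
    [\/ a = point, b = point | c = point].
  by move=> /spair_eq_pt[->|/spair_eq_pt[->|->]]; [apply: Or31|apply: Or32|apply: Or33].
have [luv0|luv0] := eqVneq (spair l (spair u v)) point.
  by rewrite (nf_pt (pt0 _ _ _ _ _ luv0)) nf_pt //; apply: pt0; rewrite -luv.
have l0 : l != point by apply: contra luv0 => /eqP ->; rewrite spair_ptl.
have uv0 : spair u v != point by apply: contra luv0 => /eqP ->; rewrite spair_ptr.
have u0 : u != point by apply: contra uv0 => /eqP ->; rewrite spair_ptl.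
have v0 : v != point by apply: contra uv0 => /eqP ->; rewrite spair_ptr.
by have [-> /(spair_inj u0 v0)[-> ->]] := spair_inj l0 uv0 luv.
Qed.

Lemma sday_ssmash : siso (sday E1 E2) (ssmash (smash F1 F2)).
Proof.
exists psi => k; apply: inj_surj_bij; first exact: psi_inj.
move=> p; exists (nf (val p).1 (val (val p).2).1 (val (val p).2).2).
by rewrite psi_nf !spairK.
Qed.

End DayClosure.

Lemma inC_smash E1 E2 : inC E1 -> inC E2 -> inC (sday E1 E2).
Proof.
move=> [F1 [fin1 [phi1 phi1B]]] [F2 [fin2 [phi2 phi2B]]].
exists (smash F1 F2); split; first exact: finite_smash.
exact: sday_ssmash phi1B phi2B.
Qed.

Record EndC := MkEndC {
  end_mod :> smodule;
  end_T : smor end_mod end_mod;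
  end_inC : inC end_mod }.

Definition end_iso (X Y : EndC) := exists phi : smor X Y,
  (forall k, bijective (phi k)) /\
  (forall k x, phi k (end_T X k x) = end_T Y k (phi k x)).

Definition end_image (X : EndC) : EndC :=
  MkEndC (srestr (end_T X)) (inC_image (end_T X) (end_inC X)).

Definition end_wedge (X Y : EndC) : EndC :=
  MkEndC (swmap (end_T X) (end_T Y)) (inC_wedge (end_inC X) (end_inC Y)).

Definition end_smash (X Y : EndC) : EndC :=
  MkEndC (sday_map (end_T X) (end_T Y)) (inC_smash (end_inC X) (end_inC Y)).

Definition additive_invariant (A : zmodType) (chi : EndC -> A) :=
  [/\ forall X Y, end_iso X Y -> chi X = chi Y,
      forall X, chi X = chi (end_image X)
    & forall X Y, chi (end_wedge X Y) = chi X + chi Y].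

Definition universal_additive_invariant (W : zmodType) (tau : EndC -> W) :=
  additive_invariant tau /\
  forall (A : zmodType) (chi : EndC -> A), additive_invariant chi ->
    exists f : {additive W -> A}, (forall X, f (tau X) = chi X) /\
      forall g : {additive W -> A}, (forall X, g (tau X) = chi X) -> g =1 f.

(* The unit of W is then tau(S, id), since S is the unit of the smash product
   and W is generated by the image of tau. *)
Definition is_W0 (W : comPzRingType) (tau : EndC -> W) :=
  universal_additive_invariant tau /\
  forall X Y, tau (end_smash X Y) = tau X * tau Y.

(* The ring structure that monalg puts on malg requires a monoid without
   non-trivial invertible elements, so only the additive structure is reused. *)
Definition groupring (A : zmodType) := {malg int[A]}.

Section GroupRing.
Variable A : zmodType.
Local Open Scope fset_scope.
Local Open Scope ring_scope.

HB.instance Definition _ := GRing.Zmodule.on (groupring A).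
Implicit Types (g h : groupring A) (a b : A).

Definition gr_one : groupring A := << 0 >>.

Definition gr_mul g h : groupring A :=
  \sum_(a <- msupp g) \sum_(b <- msupp h) << g@_a * h@_b *g a + b >>.

Lemma gr_mulw (d1 d2 : {fset A}) g h :
  msupp g `<=` d1 -> msupp h `<=` d2 ->
  gr_mul g h = \sum_(a <- d1) \sum_(b <- d2) << g@_a * h@_b *g a + b >>.
Proof.
move=> le_d1 le_d2; rewrite /gr_mul (big_fset_incl _ le_d1) /=.
  apply/eq_bigr=> k1 _; apply/big_fset_incl => // k _ /mcoeff_outdom ->.
  by rewrite mulr0 monalgU0.
move=> k _ /mcoeff_outdom gk.
by rewrite big1 => // k' _; rewrite gk mul0r monalgU0.
Qed.

Lemma gr_mulC : commutative gr_mul.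
Proof.
move=> g h; rewrite /gr_mul exchange_big; apply: eq_bigr => b _.
by apply: eq_bigr => a _; rewrite mulrC addrC.
Qed.

Lemma gr_mulUg c a g :
  gr_mul << c *g a >> g = \sum_(b <- msupp g) << c * g@_b *g a + b >>.
Proof.
rewrite (gr_mulw msuppU_le (fsubset_refl _)) big_seq_fset1.
by apply/eq_bigr => k' _; rewrite mcoeffUU.
Qed.

Lemma gr_mulUU c1 c2 a b :
  gr_mul << c1 *g a >> << c2 *g b >> = << c1 * c2 *g a + b >>.
Proof. by rewrite (gr_mulw msuppU_le msuppU_le) !big_seq_fset1 !mcoeffUU. Qed.

Lemma gr_mul1g : left_id gr_one gr_mul.
Proof.
move=> g; rewrite gr_mulUg [RHS]monalgE.
by apply/eq_bigr=> b _; rewrite mul1r add0r.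
Qed.

Lemma gr_mulDl : left_distributive gr_mul +%R.
Proof.
move=> g1 g2 g.
rewrite [in RHS](gr_mulw (fsubsetUl _ (msupp g2)) (fsubset_refl _)).
rewrite [in RHS](gr_mulw (fsubsetUr (msupp g1) _) (fsubset_refl _)).
rewrite (gr_mulw (msuppD_le _ _) (fsubset_refl _)).
rewrite -big_split /=; apply/eq_bigr=> k1 _.
rewrite -big_split /=; apply/eq_bigr=> k2 _.
by rewrite mcoeffD mulrDl monalgUD.
Qed.

Lemma gr_mulDr : right_distributive gr_mul +%R.
Proof. by move=> g g1 g2; rewrite gr_mulC gr_mulDl ![gr_mul _ g]gr_mulC. Qed.

Lemma gr_mul0g : left_zero 0 gr_mul.
Proof. by move=> g; rewrite /gr_mul msupp0 big_seq_fset0. Qed.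

Lemma gr_mulg0 : right_zero 0 gr_mul.
Proof. by move=> g; rewrite gr_mulC gr_mul0g. Qed.

Lemma gr_mul_suml I (r : seq I) (F : I -> groupring A) g :
  gr_mul (\sum_(i <- r) F i) g = \sum_(i <- r) gr_mul (F i) g.
Proof. exact: (big_morph (gr_mul^~ g) (fun x y => gr_mulDl x y g) (gr_mul0g g)). Qed.

Lemma gr_mul_sumr I (r : seq I) (F : I -> groupring A) g :
  gr_mul g (\sum_(i <- r) F i) = \sum_(i <- r) gr_mul g (F i).
Proof. exact: (big_morph (gr_mul g) (gr_mulDr g) (gr_mulg0 g)). Qed.

Lemma gr_mulA : associative gr_mul.
Proof.
move=> g1 g2 g3; rewrite [g1]monalgE (gr_mul_suml _ _ (gr_mul g2 g3)).
rewrite (gr_mul_suml _ _ g2) (gr_mul_suml _ _ g3).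
apply: eq_bigr => a _.
rewrite [g2]monalgE (gr_mul_suml _ _ g3) !(gr_mul_sumr _ _ << g1@_a *g a >>).
rewrite (gr_mul_suml _ _ g3); apply: eq_bigr => b _.
rewrite [g3]monalgE (gr_mul_sumr _ _ << g2@_b *g b >>) (gr_mul_sumr _ _ << g1@_a *g a >>).
rewrite (gr_mul_sumr _ _ (gr_mul << g1@_a *g a >> _)); apply: eq_bigr => c _.
by rewrite !gr_mulUU mulrA addrA.
Qed.

Lemma gr_one_neq0 : gr_one != 0.
Proof. by apply/eqP/malgP=> /(_ 0) /eqP; rewrite !mcoeffsE oner_eq0. Qed.

HB.instance Definition _ := GRing.Zmodule_isComNzRing.Build (groupring A)
  gr_mulA gr_mulC gr_mul1g gr_mulDl gr_one_neq0.

End GroupRing.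

(* The extension e(a) |-> e(sigma a) of sigma to the group rings. *)
Definition gr_map (A B : zmodType) (sigma : A -> B) (g : groupring A) :
  groupring B := \sum_(a <- msupp g) << g@_a *g sigma a >>.

Section GroupRingMap.
Variables A B : zmodType.
Local Open Scope fset_scope.
Local Open Scope ring_scope.

Lemma gr_mapw (sigma : A -> B) (d : {fset A}) g : msupp g `<=` d ->
  gr_map sigma g = \sum_(a <- d) << g@_a *g sigma a >>.
Proof.
move=> le_d; apply: big_fset_incl => // k _ /mcoeff_outdom ->.
exact: monalgU0.
Qed.

Lemma gr_mapU (sigma : A -> B) c a : gr_map sigma << c *g a >> = << c *g sigma a >>.
Proof. by rewrite (gr_mapw sigma msuppU_le) big_seq_fset1 mcoeffUU. Qed.

Lemma gr_mapB (sigma : A -> B) : {morph gr_map sigma : g h / g - h}.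
Proof.
move=> g h; rewrite (gr_mapw sigma (fsubsetUl (msupp g) (msupp h))).
rewrite (gr_mapw sigma (fsubsetUr (msupp g) (msupp h))).
have le : msupp (g - h) `<=` msupp g `|` msupp h := msuppB_le g h.
rewrite [LHS](gr_mapw sigma le) -[RHS]sumrB.
by apply: eq_bigr => a _; rewrite [(g - h)@_a]mcoeffB monalgUB.
Qed.

Lemma gr_map0 (sigma : A -> B) : gr_map sigma 0 = 0.
Proof. by rewrite /gr_map msupp0 big_seq_fset0. Qed.

Lemma gr_mapD (sigma : A -> B) : {morph gr_map sigma : g h / g + h}.
Proof.
move=> g h; rewrite -[in LHS](opprK h) gr_mapB; congr (_ + _).
by rewrite -[- h]add0r gr_mapB gr_map0 add0r opprK.
Qed.

Lemma gr_map_sum (sigma : A -> B) I (r : seq I) (F : I -> groupring A) :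
  gr_map sigma (\sum_(i <- r) F i) = \sum_(i <- r) gr_map sigma (F i).
Proof. exact: (big_morph _ (gr_mapD sigma) (gr_map0 sigma)). Qed.

Lemma gr_map1 (sigma : {additive A -> B}) : gr_map sigma 1 = 1.
Proof. by rewrite [LHS]gr_mapU raddf0. Qed.

Lemma gr_mapM (sigma : {additive A -> B}) : {morph gr_map sigma : g h / g * h}.
Proof.
move=> g h; rewrite [g * h]/(gr_mul g h) gr_map_sum [gr_map _ g]/gr_map mulr_suml.
apply: eq_bigr => a _; rewrite gr_map_sum mulr_sumr; apply: eq_bigr => b _.
by rewrite gr_mapU [RHS]gr_mulUU raddfD.
Qed.

End GroupRingMap.

(* Num.int_num_subdef is the predicate underlying Num.int. *)
Definition int_in_rat : zmodClosed rat :=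
  GRing.ZmodClosed.clone rat Num.int_num_subdef _.

Definition QZ := {ideal_quot int_in_rat}.
HB.instance Definition _ := GRing.Zmodule.on QZ.
HB.instance Definition _ := EqQuotient.on QZ.

Definition gr_inv : {pred groupring QZ} := fun f =>
  `[< forall sigma : {additive QZ -> QZ}, bijective sigma -> gr_map sigma f = f >].

Lemma gr_inv_subring : subring_closed gr_inv.
Proof.
split=> [|f g /asboolP fI /asboolP gI|f g /asboolP fI /asboolP gI].
- by apply/asboolP => s _; apply: gr_map1.
- by apply/asboolP => s sB; rewrite gr_mapB fI // gI.
- by apply/asboolP => s sB; rewrite gr_mapM fI // gI.
Qed.
HB.instance Definition _ :=
  GRing.isSubringClosed.Build (groupring QZ) gr_inv gr_inv_subring.

Record ZQZinv := MkZQZinv { ZQZinv_val :> groupring QZ; _ : ZQZinv_val \in gr_inv }.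
HB.instance Definition _ := [isSub for ZQZinv_val].
HB.instance Definition _ := [Choice of ZQZinv by <:].
HB.instance Definition _ := [SubChoice_isSubComNzRing of ZQZinv by <:].

(* zres n N is the residue of n modulo N.+1. *)
Record Zhat := MkZhat {
  zres :> forall N, 'I_N.+1;
  zres_compat : forall M N, (M.+1 %| N.+1)%N -> (zres N %% M.+1)%N = zres M }.

(* s is killed by the denominator of any of its representatives. *)
Definition zhat_act (n : Zhat) (s : QZ) : QZ := s *+ n `|denq (repr s)|.-1.

Definition expi (R : realType) (x : R) : R[i] := (cos x +i* sin x)%C.

Definition pairing (R : realType) (s : QZ) (n : Zhat) : R[i] :=
  expi (2 * pi * ratr (repr (zhat_act n s))).

Definition fourier (R : realType) (f : groupring QZ) (n : Zhat) : R[i] :=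
  \sum_(s <- msupp f) (f@_s)%:~R * pairing R s n.

Section Trace.
Variables (F : pointedType) (T : F -> F).

Definition stable_set : set F := \bigcap_(n in [set: nat]) (iter n T @` [set: F]).

Definition is_period (N : nat) :=
  (0 < N)%N /\ forall x, stable_set x -> iter N T x = x.

(* T is a permutation of finite order on the stable set of a finite F, and the
   result on that set does not depend on the period that xget selects. *)
Definition zhat_iter (n : Zhat) : F -> F :=
  iter (n (xget 1%N is_period).-1) T.

Definition ptrace (D : set F) (S : F -> F) : int :=
  (#|` fset_set (D `&` [set x | S x = x])|)%fset%:Z - 1.

Definition stable_trace (n : Zhat) : int := ptrace stable_set (zhat_iter n).

End Trace.

Definition end_trace (X : EndC) (n : Zhat) : int :=
  stable_trace (end_T X 1%N) n.

(* Main.v *)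
Require Import Defs.
From HB Require Import structures.
From mathcomp Require Import all_boot all_order all_algebra.
From mathcomp Require Import finmap generic_quotient ring_quotient monalg.
From mathcomp Require Import boolp classical_sets functions cardinality.
From mathcomp Require Import reals trigo complex.
From mathcomp Require Import zify lra.
From Stdlib Require Import Relation_Operators.

(** An object (E, T) of End(C) is determined by the pointed self-map of the
    finite pointed set E(1_+). Passing to images makes this map a permutation,
    and a permutation is a wedge of cycles; hence an additive invariant is
    determined by its values on the cycles of length l > 0 (EndC_ind,
    additive_invariant_ext).

    The trace of T^n on the stable part of E(1_+) is itself an invariant for
    each profinite integer n, additive under wedges and multiplicative under
    smash products (end_trace_wedge, end_trace_smash). For the cycle of length
    l it is l if l divides n and 0 otherwise, which is the Fourier transform of
    the sum of e(s) over the l-torsion elements s of Q/Z (fourier_torsion_sum,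
    end_trace_cycle). By reduction to cycles, the trace of every (E, T) is the
    Fourier transform of an invariant element tau(E, T) of Z[Q/Z]. The Fourier
    transform is injective, by the linear independence of distinct characters
    (fourier_inj), so tau(E, T) is unique and tau inherits additivity and
    multiplicativity from the traces.

    Universality of tau amounts to the claim that the sums over the l-torsion,
    for l > 0, form a Z-basis of the invariants. Any two elements of Q/Z of the
    same order are exchanged by an automorphism (qz_automorphism), so that an
    invariant is a combination of the sums of e(s) over all s of a given order.
    The sum over the l-torsion has coefficient 1 at the elements of order l and
    otherwise involves only smaller orders; this triangularity yields
    generation (ZQZinv_gen) and independence (ZQZinv_ext).

    Finally, any other W_0 is additively isomorphic to this one by universality,
    and the isomorphism is multiplicative because it is so on the values of
    tau, which generate (universal_gen). *)

Set Implicit Arguments.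
Unset Strict Implicit.
Unset Printing Implicit Defensive.

Import Order.TTheory GRing.Theory Num.Theory.

Local Open Scope ring_scope.
Local Open Scope quotient_scope.

(** * Torsion and automorphisms of Q/Z *)

Lemma qz_eq0 (x : rat) : (\pi_QZ x == 0) = (x \is a Num.int).
Proof.
rewrite -[x in RHS]subr0 -[RHS]/(x - 0 \in int_in_rat) Quotient.idealrBE.
by rewrite (raddf0 (\pi_QZ : {additive rat -> QZ})).
Qed.

Definition qzord (s : QZ) : nat := `|denq (repr s)|%N.

Lemma qzord_gt0 s : (0 < qzord s)%N.
Proof. by rewrite absz_gt0 denq_neq0. Qed.

Lemma rat_mulrn_int (r : rat) m : (r *+ m \is a Num.int) = (`|denq r| %| m)%N.
Proof.
have d0 : (denq r)%:~R != 0 :> rat by rewrite intr_eq0 denq_neq0.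
apply/idP/idP => [/intrP[z zE]|/dvdnP[q ->]].
  have : (numq r * m%:Z = z * denq r)%R.
    apply/eqP; rewrite -(eqr_int rat) !rmorphM /= -zE.
    by rewrite -[r in X in _ == X * _]divq_num_den -mulr_natr mulrAC divfK.
  move=> /(congr1 absz); rewrite !abszM /= => E.
  rewrite -(@Gauss_dvdr _ `|numq r|) ?E ?dvdn_mull //.
  by rewrite coprime_sym; apply: coprime_num_den.
have -> : r *+ (q * `|denq r|) = (numq r * q%:Z)%:~R.
  have dE : `|denq r|%N%:R = (denq r)%:~R :> rat by rewrite -[in RHS]absz_denq.
  rewrite -{1}[r]divq_num_den rmorphM /= -[LHS]mulr_natr natrM dE.
  by rewrite [q%:R * _]mulrC mulrA divfK.
exact: intr_int.
Qed.

Lemma qz_mulrn_eq0 (s : QZ) m : (s *+ m == 0) = (qzord s %| m)%N.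
Proof. by rewrite -rat_mulrn_int -qz_eq0 raddfMn /= reprK. Qed.

Definition qinv (d : nat) : QZ := \pi_QZ (d%:R^-1).

Lemma qinv_mulrn d : (0 < d)%N -> qinv d *+ d = 0.
Proof.
move=> d0; apply/eqP; rewrite -raddfMn qz_eq0 /= -[_^-1 *+ _]mulr_natr mulVf ?rpred1 //.
by rewrite pnatr_eq0 -lt0n.
Qed.

Lemma qinv_mulrn_eq0 d m : (0 < d)%N -> (qinv d *+ m == 0) = (d %| m)%N.
Proof.
move=> d0; have d1 : d%:R != 0 :> rat by rewrite pnatr_eq0 -lt0n.
apply/idP/idP => [|/dvdnP[q ->]]; last first.
  by rewrite mulnC mulrnA qinv_mulrn // mul0rn.
rewrite -raddfMn qz_eq0 /= -[_^-1 *+ _]mulr_natr => /intrP[z zE].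
have : (m%:Z = z * d%:Z)%R.
  by apply/eqP; rewrite -(eqr_int rat) rmorphM /= -zE mulrAC mulVf ?mul1r.
by move=> /(congr1 absz); rewrite abszM /= => ->; apply: dvdn_mull.
Qed.

Lemma qzord_qinv d : (0 < d)%N -> qzord (qinv d) = d.
Proof.
move=> d0; apply/eqP; rewrite eqn_dvd -qz_mulrn_eq0 qinv_mulrn // eqxx /=.
by rewrite -qinv_mulrn_eq0 // qz_mulrn_eq0.
Qed.

(** The d-torsion of Q/Z is cyclic, generated by 1/d: a representative of a
    d-torsion class is z/d with z an integer, and z matters only modulo d. *)
Lemma qz_torsion s d : (0 < d)%N -> s *+ d = 0 ->
  exists2 k : 'I_d, s = qinv d *+ k & (qzord s = d -> coprime k d).
Proof.
move=> d0 sd; have d1 : d%:R != 0 :> rat by rewrite pnatr_eq0 -lt0n.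
have [k sk] : exists k : 'I_d, s = qinv d *+ k.
  have := sd; rewrite -[s in s *+ _]reprK -raddfMn => /eqP.
  rewrite qz_eq0 /= => /intrP[z zE].
  have zd : (`|(z %% d)%Z| < d)%N by rewrite -ltz_nat gez0_abs ?modz_ge0 ?ltz_pmod //; lia.
  exists (Ordinal zd) => /=.
  have -> : s = \pi_QZ (z%:~R / d%:R) by rewrite -zE -[_ *+ _]mulr_natr mulfK // reprK.
  apply/eqP; rewrite -subr_eq0 -raddfMn -raddfB qz_eq0 /=.
  have -> : z%:~R / d%:R - d%:R^-1 *+ `|(z %% d)%Z| = (z %/ d)%Z%:~R :> rat.
    have zm : `|(z %% d)%Z|%N%:R = ((z %% d)%Z)%:~R :> rat.
      by rewrite -[in RHS](gez0_abs (modz_ge0 _ _)) // eqz_nat -lt0n.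
    rewrite -[_^-1 *+ _]mulr_natr zm [_^-1 * _]mulrC -mulrBl -rmorphB /= {1}(divz_eq z d) addrK.
    by rewrite rmorphM /= mulfK.
  exact: intr_int.
exists k => // sord; rewrite /coprime.
have g0 : (0 < gcdn k d)%N by rewrite gcdn_gt0 d0 orbT.
have : s *+ (d %/ gcdn k d) == 0.
  rewrite sk -mulrnA qinv_mulrn_eq0 // muln_divCA_gcd.
  exact: dvdn_mulr.
rewrite qz_mulrn_eq0 sord => /dvdn_leq; rewrite divn_gt0 // dvdn_leq ?dvdn_gcdr //.
move=> /(_ isT) le; apply/eqP.
have := divnK (dvdn_gcdr k d); nia.
Qed.

(** All elements of order d are conjugate under automorphisms. Here
    the automorphism is multiplication by the unit of the profinite integers
    that is k at the primes dividing d and 1 at all other primes; its residue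
    modulo N is given by the Chinese remainder theorem. *)
Lemma qz_automorphism d k : (0 < d)%N -> coprime k d ->
  exists sigma : {additive QZ -> QZ}, bijective sigma /\
    sigma (qinv d) = qinv d *+ k.
Proof.
move=> d0 kd; pose p := \pi(d).
pose u N := chinese (N`_p) (N`_p^') k 1.
have pp N : coprime N`_p N`_p^' by apply: coprime_partC.
have u1 N : (u N = k %[mod N`_p])%N by apply: chinese_modl.
have u2 N : (u N = 1 %[mod N`_p^'])%N by apply: chinese_modr.
have uM M N : (0 < N)%N -> (M %| N)%N -> (u N = u M %[mod M])%N.
  move=> N0 MN; have M0 : (0 < M)%N by apply: dvdn_gt0 MN.
  apply/eqP; have := chinese_remainder (pp M) (u N) (u M).
  rewrite partnC // => ->.
  have mp (pi : nat_pred) a b : (a = b %[mod N`_pi])%N -> (a == b %[mod M`_pi])%N.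
    by move=> ab; rewrite -(modn_dvdm _ (partn_dvd pi N0 MN)) ab modn_dvdm // partn_dvd.
  by rewrite !(eqP (mp _ _ _ (u1 N))) !(eqP (mp _ _ _ (u2 N))) u1 u2 !eqxx.
have uC N : (0 < N)%N -> coprime (u N) N.
  move=> N0; have := coprimeMr (u N) N`_p N`_p^'; rewrite partnC // => ->.
  rewrite -coprime_modl u1 coprime_modl -[in X in _ && X]coprime_modl u2.
  rewrite coprime_modl coprime1n andbT.
  have [x|x] := posnP k.
    move: kd; rewrite x /coprime gcd0n /p => /eqP ->.
    by rewrite part_p'nat //; apply/pnatP => // q _ _; rewrite !inE.
  rewrite (coprime_sym k) (pnat_coprime (part_pnat p N)) //.
  by rewrite /p -coprime_pi' // coprime_sym.
have ud : (u d = k %[mod d])%N by have := u1 d; rewrite part_pnat_id // pnat_pi.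
have mn (s : QZ) N a b : s *+ N = 0 -> (a = b %[mod N])%N -> s *+ a = s *+ b.
  move=> sN ab; rewrite (divn_eq a N) (divn_eq b N) ab !mulrnDr.
  by rewrite ![(_ * N)%N]mulnC !mulrnA sN !mul0rn.
have ordK (s : QZ) : s *+ qzord s = 0 by apply/eqP; rewrite qz_mulrn_eq0.
pose sg s := s *+ u (qzord s).
have sgE s N : (0 < N)%N -> s *+ N = 0 -> sg s = s *+ u N.
  move=> N0 /eqP sN; apply: (mn _ (qzord s)) => //; apply/esym/uM => //.
  by rewrite -qz_mulrn_eq0.
have sgB : zmod_morphism sg.
  move=> s t; pose N := (qzord s * qzord t)%N.
  have N0 : (0 < N)%N by rewrite muln_gt0 !qzord_gt0.
  have sN : s *+ N = 0 by rewrite mulrnA ordK mul0rn.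
  have tN : t *+ N = 0 by rewrite /N mulnC mulrnA ordK mul0rn.
  by rewrite !(sgE _ N) // mulrnBl // sN tN subrr.
pose H := GRing.isZmodMorphism.Build QZ QZ sg sgB.
pose sigma : {additive QZ -> QZ} := HB.pack sg H.
have sigmaE s : sigma s = sg s by [].
exists sigma; split; last first.
  by rewrite sigmaE (sgE _ d) ?qinv_mulrn //; apply: mn ud; rewrite qinv_mulrn.
apply: inj_surj_bij.
  apply: raddf_inj => s; rewrite sigmaE => /eqP; rewrite qz_mulrn_eq0 => dv.
  have := uC _ (qzord_gt0 s); rewrite /coprime => /eqP E.
  have := dvdn_gcd (qzord s) (u (qzord s)) (qzord s); rewrite dv dvdnn E dvdn1 => /eqP o1.
  by rewrite -[s]mulr1n -o1 ordK.
move=> t; have N0 := qzord_gt0 t; set N := qzord t in N0 *.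
(* v is 1 modulo N and a multiple of u N, so v / u N inverts u N modulo N. *)
pose v := chinese N (u N) 1 0.
have vN : (v = 1 %[mod N])%N by apply: chinese_modl; rewrite coprime_sym uC.
have vu : (u N %| v)%N.
  by rewrite /dvdn /v chinese_modr ?mod0n // coprime_sym uC.
exists (t *+ (v %/ u N)); rewrite sigmaE (sgE _ N) //; last first.
  by rewrite -mulrnA mulnC mulrnA ordK mul0rn.
by rewrite -mulrnA divnK // (mn _ N _ 1%N).
Qed.

(** * The group ring of Q/Z and its invariants *)

Section LinearExtension.
Variables (A B : zmodType) (y : A -> B).
Local Open Scope fset_scope.
Local Open Scope ring_scope.

Definition gr_ext (g : groupring A) : B := \sum_(a <- msupp g) y a *~ g@_a.

Lemma gr_extw (d : {fset A}) g : msupp g `<=` d ->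
  gr_ext g = \sum_(a <- d) y a *~ g@_a.
Proof.
by move=> le_d; apply: big_fset_incl => // a _ /mcoeff_outdom ->; rewrite mulr0z.
Qed.

Lemma gr_extB : {morph gr_ext : g h / g - h}.
Proof.
move=> g h; rewrite (gr_extw (fsubsetUl (msupp g) (msupp h))).
rewrite (gr_extw (fsubsetUr (msupp g) (msupp h))).
have le : msupp (g - h) `<=` msupp g `|` msupp h := msuppB_le g h.
rewrite [LHS](gr_extw le) -[RHS]sumrB.
by apply: eq_bigr => a _; rewrite [(g - h)@_a]mcoeffB mulrzBr.
Qed.
HB.instance Definition _ := GRing.isZmodMorphism.Build (groupring A) B gr_ext gr_extB.

Lemma gr_extU c a : gr_ext << c *g a >> = y a *~ c.
Proof. by rewrite (gr_extw msuppU_le) big_seq_fset1 mcoeffUU. Qed.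

End LinearExtension.

Lemma gr_map_coef (A B : zmodType) (sigma : A -> B) (g : groupring A) a :
  injective sigma -> (gr_map sigma g)@_(sigma a) = g@_a.
Proof.
move=> sI; rewrite [g in RHS]monalgE /gr_map !raddf_sum.
by apply: eq_bigr => b _ /=; rewrite !mcoeffU inj_eq.
Qed.

(** The sum of e(s) over the l-torsion, which is the image of a cycle of
    length l under the universal invariant. *)
Definition torsion_sum (l : nat) : groupring QZ := \sum_(j < l) << qinv l *+ j >>.

Lemma qinv_mulrn_inj l (i j : 'I_l) : qinv l *+ i = qinv l *+ j -> i = j.
Proof.
wlog ij : i j / (i <= j)%N => [H|].
  by case/orP: (leq_total i j) => ij E; [|symmetry]; apply: H.
have l0 : (0 < l)%N by apply: leq_ltn_trans (ltn_ord i).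
move=> /eqP; rewrite eq_sym -subr_eq0 -mulrnBr // qinv_mulrn_eq0 //.
move=> /dvdn_leq; have := ltn_ord j; case: (posnP (j - i)) => [z _ _|p jl /(_ isT)].
  by apply: val_inj => /=; lia.
by lia.
Qed.

Lemma torsion_sum_coef l s : (0 < l)%N -> (torsion_sum l)@_s = (s *+ l == 0)%:R.
Proof.
move=> l0; rewrite /torsion_sum raddf_sum /=; case: eqP => [sl|sl].
  have [k -> _] := qz_torsion l0 sl.
  rewrite (bigD1 k) //= mcoeffU eqxx big1 ?addr0 // => j jk.
  rewrite mcoeffU; case: eqP => // E; move: jk.
  by rewrite (qinv_mulrn_inj E) eqxx.
rewrite big1 // => j _; rewrite mcoeffU; case: eqP => // jE; case: sl.
by rewrite -jE mulrnAC qinv_mulrn // mul0rn.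
Qed.

Lemma torsion_sum_inv l : torsion_sum l \in gr_inv.
Proof.
apply/asboolP => sg sB; have sI := bij_inj sB; case: (posnP l) => [->|l0].
  by rewrite /torsion_sum big_ord0 gr_map0.
apply/malgP => t; have [g _ gK] := sB.
rewrite -[t]gK [LHS]gr_map_coef // ![(torsion_sum l)@_ _]torsion_sum_coef //.
by rewrite -(raddfMn sg) (raddf_eq0 _ sI).
Qed.

Definition torsion_inv l : ZQZinv := MkZQZinv (torsion_sum_inv l).

(** An invariant has constant coefficients on each orbit of the automorphism
    group, and the orbits are the sets of elements of a given order. *)
Lemma gr_inv_coef (g : ZQZinv) s : (\val g)@_s = (\val g)@_(qinv (qzord s)).
Proof.
have /eqP sd : s *+ qzord s == 0 by rewrite qz_mulrn_eq0.
have [k sE /(_ erefl) kd] := qz_torsion (qzord_gt0 s) sd.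
have [sg [sB sgE]] := qz_automorphism (qzord_gt0 s) kd.
case: g => g /= /asboolP/(_ sg sB) gE.
by rewrite -[in RHS](gr_map_coef _ _ (bij_inj sB)) gE sgE -sE.
Qed.

(** The sums over torsion subgroups generate the invariants: subtracting a
    multiple of the one of level n kills the coefficients at the elements of
    the largest order n in the support, since these coefficients all agree. *)
Lemma ZQZinv_gen (A : zmodType) (f1 f2 : {additive ZQZinv -> A}) :
  (forall l, (0 < l)%N -> f1 (torsion_inv l) = f2 (torsion_inv l)) -> f1 =1 f2.
Proof.
move=> f12 g.
have [n] : exists n, forall s, (\val g)@_s != 0 -> (qzord s <= n)%N.
  exists (\max_(s <- msupp (\val g) | predT s) qzord s)%N => s gs.
  rewrite mcoeff_neq0 in gs.
  by rewrite (leq_bigmax_seq (r := enum_fset (msupp (\val g))) (P := predT) (F := qzord)).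
elim: n g => [|n IHn] g gn.
  have -> : g = 0; last by rewrite !raddf0.
  apply/val_inj/malgP => s; rewrite mcoeff0; apply/eqP; apply: contraT => /gn.
  by rewrite leqNgt qzord_gt0.
pose c := (\val g)@_(qinv n.+1); pose h := g - torsion_inv n.+1 *~ c.
have -> : g = h + torsion_inv n.+1 *~ c by rewrite subrK.
rewrite (raddfD f1) (raddfD f2) (raddfMz f1) (raddfMz f2) f12 // (IHn h) // => s.
have hs : (\val h)@_s = (\val g)@_s - (s *+ n.+1 == 0)%:R *~ c.
  by rewrite /h rmorphB raddfMz /= mcoeffB raddfMz /= torsion_sum_coef.
rewrite hs qz_mulrn_eq0; case: (ltngtP (qzord s) n.+1) => // [sn|sn].
  have [->|/gn] := eqVneq ((\val g)@_s) 0; last by rewrite leqNgt sn.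
  by rewrite gtnNdvd // mul0rz subr0 eqxx.
by rewrite gr_inv_coef sn dvdnn /c intz subrr eqxx.
Qed.


(** The same sums are linearly independent, in the sense that an additive map
    may take arbitrary values c l on them. It is obtained by restricting the
    linear extension of a weight y on Q/Z supported on the fractions 1/d. In
    the l-torsion every element other than 1/l has order less than l or has
    weight 0, so the weight of 1/l can be solved for recursively. *)
Lemma ZQZinv_ext (A : zmodType) (c : nat -> A) :
  exists f : {additive ZQZinv -> A}, forall l, (0 < l)%N -> f (torsion_inv l) = c l.
Proof.
(* Y N is the part of the weight carried by 1/1, ..., 1/N. *)
pose step (N : nat) (Y : QZ -> A) (s : QZ) : A :=
  if s == qinv N.+1 then c N.+1 - \sum_(j < N.+1) Y (qinv N.+1 *+ j) else Y s.
pose fix Y (N : nat) : QZ -> A := if N is M.+1 then step M (Y M) else fun=> 0.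
have YS N s : s != qinv N.+1 -> Y N.+1 s = Y N s.
  by rewrite /= /step => /negbTE ->.
have Y0 N s : (N < qzord s)%N -> Y N s = 0.
  elim: N => // N IHN Ns; rewrite YS ?IHN ?(ltnW Ns) //.
  by apply: contraTneq Ns => ->; rewrite qzord_qinv // ltnn.
have YM N s : (qzord s <= N)%N -> Y N s = Y (qzord s) s.
  elim: N => [|N IHN]; first by rewrite leqNgt qzord_gt0.
  rewrite leq_eqVlt => /predU1P[-> //|sN]; rewrite YS ?IHN //.
  by apply: contraTneq sN => ->; rewrite qzord_qinv // ltnn.
pose y s := Y (qzord s) s.
have yS l : (0 < l)%N -> \sum_(j < l) y (qinv l *+ j) = c l.
  case: l => // N _.
  have -> : \sum_(j < N.+1) y (qinv N.+1 *+ j) = \sum_(j < N.+1) Y N.+1 (qinv N.+1 *+ j).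
    apply: eq_bigr => j _; rewrite YM // dvdn_leq // -qz_mulrn_eq0.
    by rewrite mulrnAC qinv_mulrn // mul0rn.
  have [k kE _] := qz_torsion (ltn0Sn N) (qinv_mulrn (ltn0Sn N)).
  have YkN : Y N (qinv N.+1 *+ k) = 0 by rewrite -kE Y0 // qzord_qinv.
  rewrite (bigD1 k) //= {1}/step -kE eqxx (bigD1 k) //= YkN add0r.
  rewrite -[RHS](subrK (\sum_(i < N.+1 | i != k) Y N (qinv N.+1 *+ i))).
  congr (_ + _); apply: eq_bigr => j jk; rewrite /step ifN //.
  by rewrite [X in _ != X]kE; apply: contra jk => /eqP E; rewrite (qinv_mulrn_inj E).
pose f (g : ZQZinv) := gr_ext y (\val g).
have fB : zmod_morphism f by move=> g h; rewrite /f -gr_extB rmorphB.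
pose H := GRing.isZmodMorphism.Build ZQZinv A f fB.
pose F : {additive ZQZinv -> A} := HB.pack f H.
exists F => l l0 /=.
rewrite /f /= /torsion_sum raddf_sum -(yS l l0); apply: eq_bigr => j _ /=.
exact: gr_extU.
Qed.

(** * Characters of Q/Z and the Fourier transform *)

(** The compatibility of residues, for moduli given by their values instead of
    their predecessors. *)
Lemma zhat_mod (n : Zhat) M N : (0 < M)%N -> (0 < N)%N -> (M %| N)%N ->
  (n N.-1 %% M)%N = n M.-1.
Proof.
move=> M0 N0 MN; have MN1 : (M.-1.+1 %| N.-1.+1)%N by rewrite !prednK.
by rewrite -(zres_compat n MN1) (prednK M0).
Qed.

Lemma zhat_actE (n : Zhat) s K : (0 < K)%N -> s *+ K = 0 ->
  zhat_act n s = s *+ n K.-1.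
Proof.
move=> K0 /eqP; rewrite qz_mulrn_eq0 /zhat_act -/(qzord s) => dK.
have d0 := qzord_gt0 s.
rewrite -(zhat_mod n d0 K0 dK) [in RHS](divn_eq (n K.-1) (qzord s)) mulrnDr mulnC mulrnA.
suff -> : s *+ qzord s = 0 by rewrite mul0rn add0r.
by apply/eqP; rewrite qz_mulrn_eq0.
Qed.

Lemma zhat_actD n s t : zhat_act n (s + t) = zhat_act n s + zhat_act n t.
Proof.
have tor u : u *+ qzord u = 0 by apply/eqP; rewrite qz_mulrn_eq0.
have K0 : (0 < qzord s * qzord t)%N by rewrite muln_gt0 !qzord_gt0.
have sK : s *+ (qzord s * qzord t) = 0 by rewrite mulrnA tor mul0rn.
have tK : t *+ (qzord s * qzord t) = 0 by rewrite mulnC mulrnA tor mul0rn.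
by rewrite !(zhat_actE n K0) // ?mulrnDl // sK tK addr0.
Qed.

Definition zhat_of_nat (m : nat) : Zhat.
Proof.
exists (fun N => Ordinal (ltn_pmod m (ltn0Sn N))) => M N MN /=.
exact: modn_dvdm.
Defined.

Section Fourier.
Variable R : realType.
Local Open Scope complex_scope.

Lemma expiD (x y : R) : expi (x + y) = expi x * expi y.
Proof. by rewrite /expi cosD sinD; simpc; congr (_ +i* _); rewrite addrC. Qed.

Lemma expi0 : expi (0 : R) = 1.
Proof. by rewrite /expi cos0 sin0. Qed.

Lemma expiN (x : R) : expi x * expi (- x) = 1.
Proof. by rewrite -expiD subrr expi0. Qed.

Lemma expi_int (k : int) : expi (2 * pi * k%:~R : R) = 1.
Proof.
have nat_case (m : nat) : expi (2 * pi * m%:R : R) = 1.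
  elim: m => [|m IHm]; first by rewrite mulr0 expi0.
  rewrite -(natr1 m) mulrDr mulr1 expiD IHm mul1r /expi mulrC mulr_natr.
  by rewrite cos2pi sin2pi.
case: k => m; first exact: nat_case.
rewrite NegzE rmorphN /= mulrN -[LHS]mul1r -[X in X * _](nat_case m.+1).
exact: expiN.
Qed.

(** Let f be the fractional part of r. If it is not 0 then sin (pi f) > 0, and
    cos (2 pi f) = 1 - 2 sin (pi f) ^ 2 is less than 1. *)
Lemma expi_eq1 (r : rat) : expi (2 * pi * ratr r : R) = 1 -> r \is a Num.int.
Proof.
pose f := r - (Num.floor r)%:~R.
have -> : ratr r = ratr f + (Num.floor r)%:~R :> R.
  by rewrite /f rmorphB /= ratr_int subrK.
rewrite (mulrDr (2 * pi)) expiD expi_int. rewrite mulr1 => -[c1 s0].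
have /andP[fl fu] := floor_itv r.
have f0 : 0 <= f by rewrite subr_ge0.
have f1 : f < 1 by move: fu; rewrite ltrBlDl rmorphD.
have f1R : ratr f < 1 :> R by rewrite -[ltRHS](rmorph1 (@ratr R)) ltr_rat.
suff: f = 0 by move/eqP; rewrite subr_eq0 => /eqP ->; apply: intr_int.
apply/eqP; rewrite eq_le f0 andbT leNgt; apply/negP => fp.
have : 0 < sin (pi * ratr f : R).
  apply: sin_gt0_pi; rewrite mulr_gt0 ?pi_gt0 ?ltr0q //=.
  by rewrite -[ltRHS]mulr1 ltr_pM2l ?pi_gt0.
have : cos ((pi * ratr f) *+ 2 : R) = 1 by rewrite -mulr_natl mulrA.
have := cos2Dsin2 (pi * ratr f : R); rewrite cos_mulr2n => E1 E2 sp.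
have : sin (pi * ratr f : R) ^+ 2 = 0 by lra.
by move=> /eqP; rewrite sqrf_eq0 => /eqP s1; rewrite s1 ltxx in sp.
Qed.

Definition qzchar (s : QZ) : R[i] := expi (2 * pi * ratr (repr s)).

Lemma qzchar_pi (x : rat) : qzchar (\pi_QZ x) = expi (2 * pi * ratr x).
Proof.
have /intrP[k kE] : x - repr (\pi_QZ x : QZ) \is a Num.int.
  by rewrite -qz_eq0 raddfB /= reprK subrr.
have xE : x = repr (\pi_QZ x : QZ) + k%:~R by rewrite -kE addrC subrK.
rewrite /qzchar [x in RHS]xE rmorphD /=.
by rewrite (mulrDr (2 * pi)) expiD ratr_int expi_int mulr1.
Qed.

Lemma qzcharD s t : qzchar (s + t) = qzchar s * qzchar t.
Proof. by rewrite -[s]reprK -[t]reprK -raddfD !qzchar_pi rmorphD (mulrDr (2 * pi)) expiD. Qed.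

Lemma qzchar0 : qzchar 0 = 1.
Proof. by rewrite -(raddf0 (\pi_QZ : {additive rat -> QZ})) qzchar_pi rmorph0 mulr0 expi0. Qed.

Lemma qzcharMn s n : qzchar (s *+ n) = qzchar s ^+ n.
Proof.
by elim: n => [|n IHn]; rewrite ?mulr0n ?qzchar0 ?expr0 // mulrS qzcharD IHn exprS.
Qed.

Lemma qzchar_eq1 s : (qzchar s == 1) = (s == 0).
Proof.
apply/eqP/eqP => [/expi_eq1|->]; last exact: qzchar0.
by rewrite -qz_eq0 reprK => /eqP.
Qed.

Lemma qzchar_inj : injective qzchar.
Proof.
move=> s t st; apply/eqP; rewrite -subr_eq0 -qzchar_eq1 qzcharD st -qzcharD.
by rewrite subrr qzchar0.
Qed.

Lemma pairingD s t n : pairing R (s + t) n = pairing R s n * pairing R t n.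
Proof. by rewrite /pairing zhat_actD; apply: qzcharD. Qed.

Lemma pairingE s n K : (0 < K)%N -> s *+ K = 0 ->
  pairing R s n = qzchar s ^+ n K.-1.
Proof. by move=> K0 sK; rewrite /pairing (zhat_actE n K0 sK); apply: qzcharMn. Qed.

Lemma pairing_nat s m : pairing R s (zhat_of_nat m) = qzchar s ^+ m.
Proof.
have tor : s *+ qzord s = 0 by apply/eqP; rewrite qz_mulrn_eq0.
rewrite (pairingE _ (qzord_gt0 s) tor) -!qzcharMn /= prednK ?qzord_gt0 //.
by rewrite [in RHS](divn_eq m (qzord s)) mulrnDr mulnC mulrnA tor mul0rn add0r.
Qed.

Lemma fourierE f n : fourier R f n = gr_ext (fun s => pairing R s n) f.
Proof. by apply: eq_bigr => s _; rewrite mulrzl. Qed.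

Lemma fourierM f g n : fourier R (f * g) n = fourier R f n * fourier R g n.
Proof.
rewrite !fourierE [f * g]/(gr_mul f g) /gr_mul raddf_sum /= mulr_suml.
apply: eq_bigr => s _; rewrite raddf_sum mulr_sumr; apply: eq_bigr => t _ /=.
rewrite gr_extU pairingD mulrzAl mulrzAr -mulrzA.
by rewrite [g@_t * _]mulrC.
Qed.

(** On the natural numbers the character attached to s is m |-> z_s ^ m, where
    the z_s are pairwise distinct. Hence a polynomial that vanishes at all z_s
    for s in the support but one isolates one coefficient. *)
Lemma fourier_inj f g : (forall n, fourier R f n = fourier R g n) -> f = g.
Proof.
move=> fg; apply/eqP; rewrite -subr_eq0; set h := f - g.
have h0 n : fourier R h n = 0.
  by rewrite fourierE raddfB /= -!fourierE fg subrr.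
apply/eqP/malgP => t; rewrite mcoeff0.
have [th|/mcoeff_outdom//] := boolP (t \in msupp h).
pose p := \prod_(s <- msupp h | s != t) ('X - (qzchar s)%:P).
have : \sum_(s <- msupp h) (h@_s)%:~R * p.[qzchar s] = 0.
  under eq_bigr do rewrite horner_coef mulr_sumr.
  rewrite exchange_big big1 //= => k _.
  transitivity (p`_k * fourier R h (zhat_of_nat k)); last by rewrite h0 mulr0.
  rewrite mulr_sumr; apply: eq_bigr => s _.
  by rewrite pairing_nat mulrCA.
rewrite (bigD1_seq t) //= ?fset_uniq // big_seq_cond big1 ?addr0 => [|s /andP[sh st]].
  move/eqP; rewrite mulf_eq0 intr_eq0 => /orP[/eqP//|].
  rewrite horner_prod prodf_seq_eq0 => /hasP[s _ /andP[st]].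
  by rewrite hornerXsubC subr_eq0 => /eqP/qzchar_inj E; rewrite E eqxx in st.
apply/eqP; rewrite mulf_eq0 horner_prod prodf_seq_eq0; apply/orP; right.
by apply/hasP; exists s => //; rewrite st hornerXsubC subrr eqxx.
Qed.

(** A geometric sum: the powers of an l-th root of unity z add up to l if z = 1
    and to 0 otherwise. *)
Lemma fourier_torsion_sum l n K : (0 < l)%N -> (l %| K)%N -> (0 < K)%N ->
  fourier R (torsion_sum l) n = ((l %| n K.-1) * l)%N%:R.
Proof.
move=> l0 lK K0; set m := n K.-1; pose z := qzchar (qinv l *+ m).
have -> : fourier R (torsion_sum l) n = \sum_(j < l) z ^+ j.
  rewrite fourierE /torsion_sum raddf_sum; apply: eq_bigr => j _ /=.
  have jK : qinv l *+ j *+ K = 0.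
    have /dvdnP[q ->] := lK.
    by rewrite mulrnAC mulnC mulrnA qinv_mulrn // !mul0rn.
  by rewrite gr_extU [LHS]mulr1z (pairingE n K0 jK) /z -!qzcharMn mulrnAC.
have [lm|lm] := boolP (l %| m)%N.
  have -> : z = 1 by apply/eqP; rewrite qzchar_eq1 qinv_mulrn_eq0.
  by rewrite mul1n; under eq_bigr do rewrite expr1n; rewrite sumr_const card_ord.
have z1 : z - 1 != 0 by rewrite subr_eq0 qzchar_eq1 qinv_mulrn_eq0.
apply: (mulfI z1); rewrite mul0n mulr0 -subrX1 /z -qzcharMn mulrnAC qinv_mulrn //.
by rewrite mul0rn qzchar0 subrr.
Qed.
End Fourier.

(** * Traces of pointed maps *)

Definition scard (T : choiceType) (A : set T) : nat := #|` fset_set A|%fset.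

Lemma scard_image (T U : choiceType) (f : T -> U) (A : set T) : finite_set A ->
  {in A &, injective f} -> scard (f @` A)%classic = scard A.
Proof.
move=> finA fI; rewrite /scard fset_set_image // card_in_imfset // => x y.
by rewrite !in_fset_set //; apply: fI.
Qed.

Lemma scard_setU (T : choiceType) (A B : set T) : finite_set A -> finite_set B ->
  (forall x, A x -> B x -> False) -> scard (A `|` B)%classic = (scard A + scard B)%N.
Proof.
move=> finA finB AB; rewrite /scard fset_setU // cardfsU -fset_setI //.
suff -> : (A `&` B = set0)%classic by rewrite fset_set0 cardfs0 subn0.
by apply/seteqP; split=> // x [] /AB.
Qed.

Lemma scard_setX (T U : choiceType) (A : set T) (B : set U) :
  finite_set A -> finite_set B -> scard (A `*` B)%classic = (scard A * scard B)%N.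
Proof.
move=> finA finB; rewrite /scard fset_setX // -(size_allpairs pair).
apply/perm_size/uniq_perm => [||[x y]]; first exact: fset_uniq.
  by rewrite allpairs_uniq ?fset_uniq // => -[? ?] [? ?] _ _ [-> ->].
rewrite in_fsetM /=; apply/andP/allpairsP => [[xA yB]|[[x' y'] /= [xA yB [-> ->]]]//].
by exists (x, y).
Qed.

Lemma finite_bij_finType (F : choiceType) : finite_set [set: F] ->
  exists (G : finType) (e : F -> G), bijective e.
Proof.
move=> finF; have inF (x : F) : x \in fset_set [set: F] by rewrite in_fset_set // inE.
exists (fset_set [set: F] : finType), (fun x => FSetSub (inF x)).
by exists (fun x => fsval x) => // x; apply: val_inj.
Qed.

Lemma finite_surj_inj (F : choiceType) (S : F -> F) : finite_set [set: F] ->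
  (forall y, exists x, S x = y) -> injective S.
Proof.
move=> /finite_bij_finType[G [e [e' eK e'K]]] /choice[g gK].
have fI : injective (e \o g \o e').
  move=> x y /(can_inj eK) /(congr1 S); rewrite !gK; exact: (can_inj e'K).
have [f' fK f'K] := injF_bij fI.
apply: (can_inj (g := g)) => x.
suff -> : x = g (e' (f' (e x))) by rewrite gK.
by apply: (can_inj eK); rewrite [RHS]f'K.
Qed.

(** Pigeonhole on the finitely many self-maps. *)
Lemma iter_preperiodic (F : choiceType) (S : F -> F) : finite_set [set: F] ->
  exists i K, (0 < K)%N /\ forall x, iter (i + K) S x = iter i S x.
Proof.
move=> /finite_bij_finType[G [e [e' eK e'K]]].
pose f (i : 'I_#|{ffun G -> G}|.+1) := [ffun x => e (iter i S (e' x))].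
have /injectiveP : ~~ injectiveb f.
  apply/negP => /injectiveP/leq_card; by rewrite card_ord ltnn.
move=> fI; have [i [j [ij fij]]] : exists i j : 'I__, (i < j)%N /\ f i = f j.
  apply: contrapT => H; apply: fI => i j fij.
  by case: (ltngtP i j) => [lt|lt|/val_inj//]; case: H; [exists i, j|exists j, i].
exists i, (j - i)%N; rewrite subn_gt0 subnKC ?(ltnW ij) //; split=> // x.
have := congr1 (fun g : {ffun G -> G} => g (e x)) fij.
by rewrite !ffunE eK => /(can_inj eK).
Qed.

Lemma iter_mod (T : Type) (S : T -> T) p a x : iter p S x = x ->
  iter (a %% p) S x = iter a S x.
Proof.
move=> px; rewrite [in RHS](divn_eq a p) addnC iterD.
by congr (iter _ S _); elim: (a %/ p)%N => // q IHq; rewrite mulSn iterD -IHq.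
Qed.

Lemma iter_fix_mul (T : Type) (S : T -> T) p q x : iter p S x = x ->
  iter (q * p) S x = x.
Proof. by move=> px; elim: q => // q IHq; rewrite mulSn iterD IHq. Qed.

Lemma iter_pt (F : pointedType) (S : ptmap F F) m : iter m S point = point.
Proof. by elim: m => //= m ->; rewrite ptmap_pt. Qed.

Lemma iter_equivariant (F G : Type) (S : F -> F) (T : G -> G) (h : F -> G) m :
  (forall x, h (S x) = T (h x)) -> forall x, h (iter m S x) = iter m T (h x).
Proof. by move=> hS x; elim: m => //= m IHm; rewrite hS IHm. Qed.

Lemma stable_set_fix (F : pointedType) (S : F -> F) m x :
  (0 < m)%N -> iter m S x = x -> stable_set S x.
Proof.
move=> m0 mx n _; exists (iter (n * m - n) S x) => //.
rewrite -iterD subnKC ?(iter_fix_mul _ mx) //.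
by rewrite leq_pmulr.
Qed.

Lemma stable_set_iter (F : pointedType) (S : F -> F) x :
  stable_set S x -> forall i, exists y, iter i S y = x.
Proof. by move=> Sx i; have [y _ yE] := Sx i I; exists y. Qed.

Lemma exists_period (F : pointedType) (S : F -> F) : finite_set [set: F] ->
  exists K, is_period S K.
Proof.
move=> /(iter_preperiodic S)[i [K [K0 iK]]]; exists K; split=> // x.
by move=> /stable_set_iter/(_ i)[y <-]; rewrite -iterD addnC iK.
Qed.

Lemma is_period_mul (F : pointedType) (S : F -> F) K q : (0 < q)%N ->
  is_period S K -> is_period S (q * K).
Proof.
move=> q0 [K0 SK]; split=> [|x Sx]; first by rewrite muln_gt0 q0.
by apply: iter_fix_mul; apply: SK.
Qed.

Definition pfix (F : pointedType) (S : F -> F) (m : nat) : set F :=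
  [set x | x != point /\ iter m S x = x].

(** Any period K computes the trace, which allows a common period for several
    maps. Adding K to the exponent makes it positive, so that its fixed points
    lie in the stable set automatically. *)
Lemma stable_traceE (F : pointedType) (S : ptmap F F) n K :
  finite_set [set: F] -> is_period S K ->
  stable_trace S n = (scard (pfix S (n K.-1 + K)))%:Z.
Proof.
move=> finF SK; have [K0 perK] := SK.
have finA (A : set F) : finite_set A by apply: sub_finite_set finF.
rewrite /stable_trace /ptrace /zhat_iter.
have [N0 perN] : is_period S (xget 1%N (is_period S)) by apply: (xgetPex _ (ex_intro _ K SK)).
set N := xget _ _ in N0 perN *.
have NK0 : (0 < N * K)%N by rewrite muln_gt0 N0.
have -> : (stable_set S `&` [set x | iter (n N.-1) S x = x] =
    [set point] `|` pfix S (n K.-1 + K))%classic.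
  have E x : stable_set S x -> iter (n K.-1 + K) S x = iter (n N.-1) S x.
    move=> Sx; rewrite iterD perK //.
    rewrite -(zhat_mod n N0 NK0 (dvdn_mulr _ _)) // (iter_mod _ (perN _ Sx)).
    by rewrite -(zhat_mod n K0 NK0 (dvdn_mull _ _)) // (iter_mod _ (perK _ Sx)).
  apply/seteqP; split=> x /=.
    move=> [Sx xE]; have [->|x0] := eqVneq x point; [by left|right].
    by split=> //; rewrite E.
  have m0 : (0 < n K.-1 + K)%N by rewrite addn_gt0 K0 orbT.
  move=> [->|[_ xE]]; split.
  - exact: (stable_set_fix m0 (iter_pt S _)).
  - exact: iter_pt.
  - exact: (stable_set_fix m0 xE).
  - by rewrite /= -E //; apply: (stable_set_fix m0 xE).
have -> : #|` fset_set ([set point] `|` pfix S (n K.-1 + K))%classic|%fset =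
    (1 + scard (pfix S (n K.-1 + K)))%N.
  rewrite -[LHS]/(scard _) scard_setU //; first by rewrite /scard fset_set1 cardfs1.
  by move=> x -> [/eqP].
by rewrite PoszD addrAC subrr add0r.
Qed.

(** The embedding h may miss points of G that T^m moves: this covers both
    isomorphisms and, for m > 0, the inclusion of an image. *)
Lemma scard_pfix_inj (F G : pointedType) (S : F -> F) (T : G -> G)
    (h : ptmap F G) m :
  finite_set [set: F] -> injective h -> (forall x, h (S x) = T (h x)) ->
  (forall y, iter m T y = y -> exists x, h x = y) ->
  scard (pfix S m) = scard (pfix T m).
Proof.
move=> finF hI hS hsurj; rewrite -(scard_image (f := h)).
- congr scard; apply/seteqP; split=> [_ [x [x0 xE] <-]|y [y0 yE]].
    split; last by rewrite -(iter_equivariant _ hS) xE.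
    by apply: contra x0 => /eqP E; apply/eqP/hI; rewrite E ptmap_pt.
  have [x xy] := hsurj _ yE; exists x => //; split.
    by apply: contra y0 => /eqP E; rewrite -xy E ptmap_pt.
  by apply: hI; rewrite (iter_equivariant _ hS) xy.
- exact: sub_finite_set finF.
- by move=> x y _ _; apply: hI.
Qed.

Lemma scard_pfix_wedge (F G : pointedType) (S : ptmap F F) (T : ptmap G G) m :
  finite_set [set: F] -> finite_set [set: G] ->
  scard (pfix (wmap S T) m) = (scard (pfix S m) + scard (pfix T m))%N.
Proof.
move=> finF finG.
have finA (A : set F) : finite_set A by apply: sub_finite_set finF.
have finB (A : set G) : finite_set A by apply: sub_finite_set finG.
have iterE p : val (iter m (wmap S T) p) = (iter m S (val p).1, iter m T (val p).2).
  by elim: m => [|m /= ->//]; rewrite /= -surjective_pairing.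
have inlP (x : F) : (((x, point) : F * G).1 == point) || (((x, point) : F * G).2 == point).
  by rewrite /= eqxx orbT.
have inrP (y : G) : (((point, y) : F * G).1 == point) || (((point, y) : F * G).2 == point).
  by rewrite /= eqxx.
pose wl (x : F) : wedge F G := exist _ (x, point) (inlP x).
pose wr (y : G) : wedge F G := exist _ (point, y) (inrP y).
have wlI : injective wl by move=> x x' /(congr1 val)[].
have wrI : injective wr by move=> x x' /(congr1 val)[].
rewrite -(scard_image (f := wl) (finA _)) -?(scard_image (f := wr) (finB _)); first last.
- by move=> x y _ _; apply: wlI.
- by move=> x y _ _; apply: wrI.
rewrite -scard_setU; first last.
- by move=> p [x [x0 _] <-] [y _ /(congr1 val)[xE _]]; rewrite xE eqxx in x0.
- exact: finite_image.
- exact: finite_image.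
congr scard; apply/seteqP; split=> [p [p0 pE]|].
  have pP : val p = ((val p).1, (val p).2) by case: (val p).
  have [x0|x0] := eqVneq (val p).1 point.
    right; exists (val p).2; last by apply: val_inj; rewrite [RHS]pP x0.
    split=> //; last by have := congr1 snd (iterE p); rewrite pE.
    apply: contra p0 => /eqP y0; apply/eqP/val_inj.
    by rewrite [LHS]pP x0 y0.
  have y0 : (val p).2 = point.
    by case: (p) x0 => q /= /orP[/eqP ->|/eqP//]; rewrite eqxx.
  left; exists (val p).1; last by apply: val_inj; rewrite [RHS]pP y0.
  by split=> //; have := congr1 fst (iterE p); rewrite pE.
move=> p [] [x [x0 xE] <-]; split.
- by apply: contra x0 => /eqP/(congr1 val)[->].
- by apply: val_inj; rewrite iterE /= xE iter_pt.
- by apply: contra x0 => /eqP/(congr1 val)[->].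
- by apply: val_inj; rewrite iterE /= xE iter_pt.
Qed.

Lemma scard_pfix_smash (F G : pointedType) (S : ptmap F F) (T : ptmap G G) m :
  finite_set [set: F] -> finite_set [set: G] ->
  scard (pfix (smap S T) m) = (scard (pfix S m) * scard (pfix T m))%N.
Proof.
move=> finF finG.
have finA (A : set F) : finite_set A by apply: sub_finite_set finF.
have finB (A : set G) : finite_set A by apply: sub_finite_set finG.
have iterE x y : iter m (smap S T) (spair x y) = spair (iter m S x) (iter m T y).
  by elim: m => // m IHm; rewrite iterS IHm smapE.
rewrite -scard_setX // -(scard_image (f := fun p => spair p.1 p.2)); first last.
- move=> [x y] [x' y'] /set_mem[/= [x0 _] [y0 _]] _ /= /(spair_inj x0 y0)[].
  by move=> -> ->.
- exact: finite_setX.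
congr scard; apply/seteqP; split=> [p [p0 pE]|_ [[x y] [/= [x0 xE] [y0 yE]] <-]].
  have x0 : (val p).1 != point.
    by apply: contra p0 => /eqP E; rewrite -[p]spairK E spair_ptl.
  have y0 : (val p).2 != point.
    by apply: contra p0 => /eqP E; rewrite -[p]spairK E spair_ptr.
  exists (val p); last exact: spairK.
  move: pE; rewrite -{1 2}[p]spairK iterE => /esym/(spair_inj x0 y0)[E1 E2].
  by split; split.
split; last by rewrite iterE xE yE.
by apply/eqP => /spair_eq_pt[] E; rewrite E eqxx in x0 y0.
Qed.

(** * Decomposition of endomorphisms into cycles *)

Lemma ssmash_map_nat (F : pointedType) (T : ptmap F F) m n
    (f : ptmap 'I_m.+1 'I_n.+1) (x : ssmash F m) :
  smap (ptid 'I_n.+1) T (sfmap f x) =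
  sfmap (s := ssmash F) f (smap (ptid 'I_m.+1) T x).
Proof.
rewrite -[x]spairK; move: (val x).1 (val x).2 => a b.
have -> : sfmap (s := ssmash F) f (spair a b) = spair (f a) b := smapE f (ptid F) a b.
by rewrite !smapE.
Qed.

Definition ssmash_map (F : pointedType) (T : ptmap F F) :
  smor (ssmash F) (ssmash F) :=
  @SMor (ssmash F) (ssmash F) (fun k => smap (ptid 'I_k.+1) T) (ssmash_map_nat T).

Definition end_of (F : pointedType) (finF : finite_set [set: F]) (T : ptmap F F) :
  EndC := MkEndC (ssmash_map T) (inC_ssmash finF).

Lemma finite_level1 (X : EndC) : finite_set [set: X 1%N].
Proof. by have [] := inC_crit (end_inC X). Qed.

(** An endomorphism in C is determined by its level at 1_+, because each element
    of E(k_+) comes from E(1_+) along a map 1_+ -> k_+, uniquely up to base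
    points. So a bijection at level 1 extends to all levels. *)
Lemma end_of_iso (F : pointedType) (finF : finite_set [set: F]) (T : ptmap F F)
    (X : EndC) (h : ptmap F (X 1%N)) :
  bijective h -> (forall x, h (T x) = end_T X 1%N (h x)) ->
  end_iso (end_of finF T) X.
Proof.
move=> hB hT; have hI := bij_inj hB.
have [_ surj inj] := inC_crit (end_inC X).
pose asm k (p : smash 'I_k.+1 F) : X k := sfmap (kpick (val p).1) (h (val p).2).
have asmE k (i : 'I_k.+1) x : asm k (spair i x) = sfmap (kpick i) (h x).
  have pick0 : kpick (point : 'I_k.+1) = ptzero 'I_2 'I_k.+1.
    by apply: ptmapP => j /=; rewrite /kpick_fun if_same.
  have [->|i0] := eqVneq i point.
    by rewrite spair_ptl /asm /= !ptmap_pt pick0 sfmap_zero.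
  have [->|x0] := eqVneq x point; first by rewrite spair_ptr /asm /= !ptmap_pt.
  by rewrite /asm spairE.
have asm_pt k : asm k point == point by rewrite /asm /= !ptmap_pt.
have asm_nat m n (f : ptmap 'I_m.+1 'I_n.+1) (p : ssmash F m) :
    asm n (sfmap f p) = sfmap f (asm m p).
  by rewrite -[p]spairK [X in asm n X](smapE f (ptid F)) !asmE -sfmap_comp kpick_comp.
have asm0 k p : asm k p = point -> p = point.
  rewrite -[p]spairK asmE; set i := (val p).1; set x := (val p).2.
  have [->|i0] := eqVneq i point; first by rewrite spair_ptl.
  have [->|x0] := eqVneq x point; first by rewrite spair_ptr.
  have hx0 : h x != point by apply: contra x0 => /eqP E; apply/eqP/hI; rewrite E ptmap_pt.
  rewrite -[X in _ = X -> _](ptmap_pt (sfmap (kpick (point : 'I_k.+1)))).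
  by move=> /(inj _ _ _ _ _ i0 hx0)[E _]; rewrite E eqxx in i0.
have asmI k : injective (asm k).
  move=> p q pq; have [p0|p0] := eqVneq p point.
    by rewrite p0; apply/esym/(asm0 k); rewrite -pq p0; apply/eqP.
  move: pq p0; rewrite -[p]spairK -[q]spairK !asmE => pq p0.
  have i0 : (val p).1 != point by apply: contra p0 => /eqP ->; rewrite spair_ptl.
  have x0 : h (val p).2 != point.
    apply: contra p0 => /eqP E; suff -> : (val p).2 = point by rewrite spair_ptr.
    by apply: hI; rewrite E ptmap_pt.
  by have [-> /hI ->] := inj _ _ _ _ _ i0 x0 pq.
have [g _ gK] := hB.
exists (@SMor (ssmash F) X (fun k => PtMap (asm_pt k)) asm_nat); split=> k.
  apply: inj_surj_bij => [|e]; first exact: asmI.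
  have [i [x <-]] := surj k e; exists (spair i (g x)).
  by rewrite [LHS]asmE gK.
move=> x; rewrite -[x]spairK; move: (val x).1 (val x).2 => i a.
have -> : end_T (end_of finF T) k (spair i a) = spair i (T a) := smapE (ptid _) T i a.
rewrite [LHS]asmE hT -snat; congr (end_T X k _); apply/esym/asmE.
Qed.

Lemma spair2_snd (F : pointedType) (x : F) :
  (val (spair (ord_max : 'I_2) x)).2 = x.
Proof. by have [->|x0] := eqVneq x point; rewrite ?spair_ptr // spairE. Qed.

Lemma smash2_bij (F : pointedType) :
  bijective (fun p : smash 'I_2 F => (val p).2).
Proof.
exists (fun x => spair ord_max x) => [p|x]; last exact: spair2_snd.
by have [y ->] := smash2P p; rewrite spair2_snd.
Qed.

Lemma end_of_snd (F : pointedType) (finF : finite_set [set: F]) (T : ptmap F F)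
    (p : smash 'I_2 F) :
  (val (end_T (end_of finF T) 1%N p)).2 = T (val p).2.
Proof.
have [y ->] := smash2P p; rewrite spair2_snd.
have -> : end_T (end_of finF T) 1%N (spair ord_max y) = spair ord_max (T y) :=
  smapE (ptid _) T _ _.
exact: spair2_snd.
Qed.

Definition rot_fun l (x : option 'I_l) : option 'I_l := omap (@ordS l) x.
Lemma rot_fun_pt l : rot_fun (point : option 'I_l) == point.
Proof. by []. Qed.
Definition rotation l : ptmap (option 'I_l) (option 'I_l) := PtMap (rot_fun_pt l).

Lemma finite_option_ord l : finite_set [set: option 'I_l].
Proof. exact: finite_finset. Qed.

Definition end_cycle l : EndC := end_of (finite_option_ord l) (rotation l).

Definition psub (F : pointedType) (B : pred F) := {x : F | (x == point) || B x}.
HB.instance Definition _ (F : pointedType) (B : pred F) := Choice.on (psub B).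
Lemma psub_pt_subproof (F : pointedType) (B : pred F) :
  (point == point :> F) || B point.
Proof. by rewrite eqxx. Qed.
HB.instance Definition _ (F : pointedType) (B : pred F) :=
  isPointed.Build (psub B) (exist _ point (psub_pt_subproof B)).

Section SubMap.
Variables (F : pointedType) (B : pred F) (T : ptmap F F).
Hypothesis TB : forall x, B x -> (T x == point) || B (T x).

Lemma psub_map_subproof (x : psub B) : (T (val x) == point) || B (T (val x)).
Proof. by case: x => x /= /orP[/eqP ->|/TB//]; rewrite ptmap_pt eqxx. Qed.
Definition psub_fun (x : psub B) : psub B := exist _ (T (val x)) (psub_map_subproof x).
Lemma psub_fun_pt : psub_fun point == point.
Proof. by apply/eqP/val_inj; rewrite /= ptmap_pt. Qed.
Definition psub_map : ptmap (psub B) (psub B) := PtMap psub_fun_pt.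

End SubMap.

Lemma finite_psub (F : pointedType) (B : pred F) :
  finite_set [set: F] -> finite_set [set: psub B].
Proof. by apply: (finite_setT_inj (f := @proj1_sig _ _)) => p q; apply: val_inj. Qed.

Section Induction.
Variable P : EndC -> Prop.
Hypothesis P_iso : forall X Y, end_iso X Y -> (P X <-> P Y).
Hypothesis P_image : forall X, P (end_image X) -> P X.
Hypothesis P_wedge : forall X Y, P X -> P Y -> P (end_wedge X Y).
Hypothesis P_cycle : forall l, P (end_cycle l).

Let P_level1 (X Y : EndC) (h : ptmap (X 1%N) (Y 1%N)) :
  bijective h -> (forall x, h (end_T X 1%N x) = end_T Y 1%N (h x)) -> P X -> P Y.
Proof.
move=> hB hT PX; have isoY := end_of_iso (finite_level1 X) hB hT.
have isoX : end_iso (end_of (finite_level1 X) (end_T X 1%N)) X.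
  by apply: (@end_of_iso _ _ _ X (ptid (X 1%N))) => //; exists id.
by apply: (proj1 (P_iso isoY)); apply: (proj2 (P_iso isoX)).
Qed.

(** Under these conditions a and b combine to an equivariant bijection from
    level 1 of the wedge of A and B to level 1 of X. *)
Let P_join (X A B : EndC) (a : ptmap (A 1%N) (X 1%N)) (b : ptmap (B 1%N) (X 1%N)) :
  injective a -> injective b ->
  (forall x, a (end_T A 1%N x) = end_T X 1%N (a x)) ->
  (forall x, b (end_T B 1%N x) = end_T X 1%N (b x)) ->
  (forall z, (exists x, a x = z) \/ exists y, b y = z) ->
  (forall x y, a x = b y -> a x = point) -> P A -> P B -> P X.
Proof.
move=> aI bI aT bT surj disj PA PB.
pose h (p : wedge (A 1%N) (B 1%N)) : X 1%N :=
  if (val p).1 == point then b (val p).2 else a (val p).1.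
have ha p : (val p).2 = point -> h p = a (val p).1.
  by rewrite /h; case: eqP => // -> ->; rewrite !ptmap_pt.
have hb p : (val p).1 = point -> h p = b (val p).2 by rewrite /h => ->; rewrite eqxx.
have pP (p : wedge (A 1%N) (B 1%N)) : (val p).1 = point \/ (val p).2 = point.
  by case: p => p /= /orP[]/eqP ->; [left|right].
have pE (p q : wedge (A 1%N) (B 1%N)) :
  (val p).1 = (val q).1 -> (val p).2 = (val q).2 -> p = q.
  by case: p q => -[x y] pp [[x' y'] qq] /= xx yy; apply: val_inj; rewrite /= xx yy.
have h_pt : h point == point by rewrite hb //= ptmap_pt.
have hT p : h (end_T (end_wedge A B) 1%N p) = end_T X 1%N (h p).
  have [p0|p0] := pP p; last by rewrite !ha ?aT //= p0 ptmap_pt.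
  by rewrite !hb ?bT //= p0 ptmap_pt.
have a0 x : a x = point -> x = point by move=> E; apply: aI; rewrite E ptmap_pt.
have hI : injective h.
  have mixed p q : (val p).2 = point -> (val q).1 = point -> h p = h q -> p = q.
    move=> p0 q0; rewrite (ha _ p0) (hb _ q0) => E; have ap := disj _ _ E.
    apply: pE; first by rewrite q0 (a0 _ ap).
    by rewrite p0; apply: bI; rewrite -E ap ptmap_pt.
  move=> p q; have [p0|p0] := pP p; have [q0|q0] := pP q => E.
  - by apply: pE; [rewrite p0 q0|apply: bI; rewrite -!hb].
  - by apply/esym/mixed.
  - exact: mixed.
  - by apply: pE; [apply: aI; rewrite -!ha|rewrite p0 q0].
apply: (@P_level1 (end_wedge A B) X (PtMap h_pt)) => //; last exact: P_wedge.
apply: inj_surj_bij => // z; have [[x <-]|[y <-]] := surj z.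
  have w : (((x, point) : A 1%N * B 1%N).1 == point) ||
           (((x, point) : A 1%N * B 1%N).2 == point) by rewrite /= eqxx orbT.
  by exists (exist (fun p : A 1%N * B 1%N => (p.1 == point) || (p.2 == point))
    (x, point) w); rewrite /= ha.
have w : (((point, y) : A 1%N * B 1%N).1 == point) ||
         (((point, y) : A 1%N * B 1%N).2 == point) by rewrite /= eqxx.
by exists (exist (fun p : A 1%N * B 1%N => (p.1 == point) || (p.2 == point))
  (point, y) w); rewrite /= hb.
Qed.

Let snd2 (F G : pointedType) (h : ptmap F G) :
  { h' : ptmap (smash 'I_2 F) G | forall p, h' p = h (val p).2 }.
Proof.
have h_pt : (fun p : smash 'I_2 F => h (val p).2) point == point by rewrite /= ptmap_pt.
by exists (@PtMap (smash 'I_2 F) G (fun p => h (val p).2) h_pt).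
Qed.

(** Every endomorphism is reduced to cycles: if it is not surjective at level 1
    then its image is smaller, and otherwise it is a permutation, from which
    the orbit of a point can be split off as a wedge summand. *)
Lemma EndC_ind (X : EndC) : P X.
Proof.
have [n] := ubnP (scard [set: X 1%N]); elim: n X => // n IHn X Xn.
have finX := finite_level1 X; set T : ptmap (X 1%N) (X 1%N) := end_T X 1%N.
have finA (A : set (X 1%N)) : finite_set A by apply: sub_finite_set finX.
have scard_lt (G : pointedType) (f : G -> X 1%N) z : finite_set [set: G] ->
    injective f -> (forall x, f x != z) -> (scard [set: G] < n)%N.
  move=> finG fI fz; apply: leq_trans (_ : (scard [set: X 1%N] <= n)%N) => //.
  rewrite -(scard_image (f := f)) // => [|x y _ _]; last exact: fI.
  apply: fproper_ltn_card; rewrite fproperE; apply/andP; split.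
    by apply/fsubsetP => x _; rewrite in_fset_set // inE.
  apply/negP => /fsubsetP/(_ z); rewrite !in_fset_set // !inE => /(_ I)[x _] /eqP.
  by rewrite (negbTE (fz x)).
have [[z zT]|surj] := pselect (exists z, forall x, T x != z).
  apply/P_image/IHn; apply: (scard_lt (end_image X 1%N : pointedType) val z).
  - exact: finite_level1.
  - exact: val_inj.
  - by case=> y /= /asboolP[x <-].
have {}surj z : exists x, T x = z.
  apply: contrapT => H; apply: surj; exists z => x; apply/eqP => E.
  by apply: H; exists x.
have TI := finite_surj_inj finX surj.
have [[x0 x0_neq]|triv] := pselect (exists x0 : X 1%N, x0 != point); last first.
  have Xpt (x : X 1%N) : x = point.
    by apply/eqP; apply: contrapT => H; apply: triv; exists x; apply/negP.
  apply: (@P_level1 (end_cycle 0) X (ptzero _ _)) => [|x|]; last exact: P_cycle.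
  - apply: inj_surj_bij => [p q _|z]; last by exists point; rewrite [RHS]Xpt.
    have /bij_inj I := smash2_bij (option 'I_0 : pointedType); apply: I.
    by case: (val p).2 => [[]//|]; case: (val q).2 => [[]//|].
  - by rewrite [RHS]Xpt.
(* x0 is periodic, as T is injective and preperiodic. *)
have [k /andP[k0 /eqP kx0]] : exists k, (0 < k)%N && (iter k T x0 == x0).
  have [i [K [K0 iK]]] := iter_preperiodic T finX.
  exists K; rewrite K0 /=; apply/eqP.
  by elim: i iK => [|i IHi] iK; [exact: iK|apply: IHi => x; apply: TI; exact: iK].
have [l /andP[l0 /eqP lx0] lmin] : exists2 l, (0 < l)%N && (iter l T x0 == x0) &
    forall m, (0 < m)%N && (iter m T x0 == x0) -> (l <= m)%N.
  have ex : exists k, (0 < k)%N && (iter k T x0 == x0) by exists k; rewrite k0 kx0 /=.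
  by case: (ex_minnP ex) => l lP lmin; exists l.
have iterI i : injective (iter i T).
  by elim: i => [|i IHi] x y //= /TI/IHi.
have iter_inj i j : (i < l)%N -> (j < l)%N -> iter i T x0 = iter j T x0 -> i = j.
  wlog ij : i j / (i <= j)%N => [H|] il jl E.
    by case/orP: (leq_total i j) => ij; [|symmetry]; apply: H.
  have [e|ltij] := eqVneq i j => //.
  have lt : (i < j)%N by rewrite ltn_neqAle ltij.
  have : (l <= j - i)%N.
    apply: lmin; rewrite subn_gt0 lt /=; apply/eqP/(iterI i).
    by rewrite -iterD subnKC.
  by lia.
pose B (x : X 1%N) := x \notin traject T x0 l.
have orbP x : reflect (exists2 i : nat, (i < l)%N & x = iter i T x0) (x \in traject T x0 l).
  exact: trajectP.
have orb_neq i : iter i T x0 != point.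
  by apply: contra x0_neq => /eqP E; apply/eqP/(iterI i); rewrite E iter_pt.
have iter_orb i : iter i T x0 = iter (i %% l) T x0 by rewrite iter_mod.
have TB x : B x -> (T x == point) || B (T x).
  move=> Bx; apply/orP; right; apply: contra Bx => /orbP[i il E]; apply/orbP.
  exists ((i + l).-1 %% l)%N; first by rewrite ltn_pmod.
  apply: TI; rewrite -iter_orb -iterS prednK ?addn_gt0 ?l0 ?orbT //.
  by rewrite iterD lx0.
pose A := end_cycle l; pose C := end_of (finite_psub B finX) (psub_map TB).
pose af (o : option 'I_l) : X 1%N := if o is Some i then iter i T x0 else point.
have af_pt : af point == point by [].
have val_pt : (val : psub B -> X 1%N) point == point by [].
have [a aE] := snd2 (PtMap af_pt); have [b bE] := snd2 (PtMap val_pt).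
apply: (@P_join X A C a b); last 1 first.
- apply: IHn.
  have sI := bij_inj (smash2_bij (psub B : pointedType)).
  apply: (scard_lt (C 1%N) b x0); first exact: finite_level1.
    by move=> p q; rewrite !bE => /val_inj/sI.
  move=> p; rewrite bE /=; apply: contraNneq x0_neq => E.
  have := valP (val p).2; rewrite /= E => /orP[//|/negP[]].
  by apply/orbP; exists 0%N.
- have sI := bij_inj (smash2_bij (option 'I_l : pointedType)).
  move=> p q; rewrite !aE => E; apply: sI; move: E => /=.
  case: (val p).2 => [i|]; case: (val q).2 => [j|] //= E.
  + by congr Some; apply: val_inj; apply: iter_inj E.
  + by have := orb_neq i; rewrite E eqxx.
  + by have := orb_neq j; rewrite -E eqxx.
- have sI := bij_inj (smash2_bij (psub B : pointedType)).
  by move=> p q; rewrite !bE => /val_inj/sI.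
- move=> p; rewrite !aE.
  have -> : (val (end_T A 1%N p)).2 = rotation l (val p).2 := end_of_snd _ _ _.
  case: (val p).2 => [i|] /=; last by rewrite ptmap_pt.
  by rewrite -iterS [RHS]iter_orb.
- move=> p; rewrite !bE.
  by have -> : (val (end_T C 1%N p)).2 = psub_map TB (val p).2 := end_of_snd _ _ _.
- move=> z; have [->|z0] := eqVneq z point.
    by left; exists point; rewrite ptmap_pt.
  have [/orbP[i il zE]|Bz] := boolP (z \in traject T x0 l).
    left; exists (spair ord_max (Some (Ordinal il))).
    by rewrite aE spair2_snd.
  right; have zB : (z == point) || B z by rewrite /B Bz orbT.
  by exists (spair ord_max (exist _ z zB : psub B)); rewrite bE spair2_snd.
- move=> p q; rewrite aE bE /=; case: (val p).2 => [i|] //= E.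
  have := valP (val q).2; rewrite /= -E (negbTE (orb_neq i)) /= => /negP[].
  by apply/orbP; exists i.
- exact: P_cycle.
Qed.
End Induction.

(** * Traces of endomorphisms *)

Lemma end_traceE (X : EndC) n K : is_period (end_T X 1%N) K ->
  end_trace X n = (scard (pfix (end_T X 1%N) (n K.-1 + K)))%:Z.
Proof. by move=> perK; apply: stable_traceE => //; apply: finite_level1. Qed.

Lemma common_period (X Y : EndC) :
  exists K, is_period (end_T X 1%N) K /\ is_period (end_T Y 1%N) K.
Proof.
have [K1 per1] := exists_period (end_T X 1%N) (finite_level1 X).
have [K2 per2] := exists_period (end_T Y 1%N) (finite_level1 Y).
exists (K2 * K1)%N; split; first by apply: is_period_mul => //; case: per2.
by rewrite mulnC; apply: is_period_mul => //; case: per1.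
Qed.

(** The trace depends on the periodic part of the level-1 map only. *)
Lemma end_trace_level1 (X Y : EndC) (h : ptmap (X 1%N) (Y 1%N)) n :
  injective h -> (forall x, h (end_T X 1%N x) = end_T Y 1%N (h x)) ->
  (forall y m, (0 < m)%N -> iter m (end_T Y 1%N) y = y -> exists x, h x = y) ->
  end_trace X n = end_trace Y n.
Proof.
move=> hI hT hsurj; have [K [perX perY]] := common_period X Y.
rewrite (end_traceE _ perX) (end_traceE _ perY); congr Posz.
apply: (scard_pfix_inj (h := h)) => //; first exact: finite_level1.
by move=> y; apply: hsurj; have [K0 _] := perX; rewrite addn_gt0 K0 orbT.
Qed.

Lemma end_trace_iso (X Y : EndC) n : end_iso X Y -> end_trace X n = end_trace Y n.
Proof.
move=> [phi [phiB phiT]]; have [g gK Kg] := phiB 1%N.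
apply: (end_trace_level1 (h := phi 1%N)) => //; first exact: (can_inj gK).
by move=> y _ _ _; exists (g y); rewrite Kg.
Qed.

Lemma end_trace_image (X : EndC) n : end_trace (end_image X) n = end_trace X n.
Proof.
pose v : simg (end_T X) 1%N -> X 1%N := \val.
have v_pt : v point == point by [].
have vI : injective v by apply: val_inj.
apply: (end_trace_level1 (h := @PtMap (end_image X 1%N) (X 1%N) v v_pt)) => //.
move=> y [//|m] _ yE.
have yP : `[< exists x, end_T X 1%N x = y >].
  by apply/asboolP; exists (iter m (end_T X 1%N) y).
by exists (exist _ y yP).
Qed.

Lemma end_trace_wedge (X Y : EndC) n :
  end_trace (end_wedge X Y) n = end_trace X n + end_trace Y n.
Proof.
have [K [perX perY]] := common_period X Y.
have perXY : is_period (end_T (end_wedge X Y) 1%N) K.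
  have [K0 pX] := perX; have [_ pY] := perY; split=> // p Sp.
  have iterE m q : val (iter m (end_T (end_wedge X Y) 1%N) q) =
      (iter m (end_T X 1%N) (val q).1, iter m (end_T Y 1%N) (val q).2).
    by elim: m => [|m /= ->//]; rewrite /= -surjective_pairing.
  apply: (@val_inj _ _ (wedge (X 1%N) (Y 1%N))).
  rewrite iterE pX ?pY -?surjective_pairing //.
    by move=> m _; have [q <-] := stable_set_iter Sp m; exists (val q).2 => //; rewrite iterE.
  by move=> m _; have [q <-] := stable_set_iter Sp m; exists (val q).1 => //; rewrite iterE.
rewrite (end_traceE _ perX) (end_traceE _ perY) (end_traceE _ perXY) -PoszD.
congr Posz; apply: (scard_pfix_wedge (end_T X 1%N) (end_T Y 1%N)); exact: finite_level1.
Qed.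

Lemma surj_equipotent_inj (F G : choiceType) (f : F -> G) (g : G -> F) :
  finite_set [set: F] -> (forall y, exists x, f x = y) -> bijective g -> injective f.
Proof.
move=> finF fS [g' gK g'K].
suff I : injective (g \o f) by move=> x y E; apply: I; rewrite /= E.
apply: finite_surj_inj finF _ => y; have [x xE] := fS (g' y).
by exists x; rewrite /= xE g'K.
Qed.

Lemma level1_ssmash (E : smodule) (F : pointedType) : siso E (ssmash F) ->
  exists2 f : E 1%N -> F, bijective f & f point = point.
Proof.
move=> [phi phiB]; exists ((fun p : smash 'I_2 F => (val p).2) \o phi 1%N).
  exact: bij_comp (smash2_bij F) (phiB 1%N).
by rewrite /= ptmap_pt.
Qed.

Lemma bij_smash (F G F' G' : pointedType) (f : ptmap F F') (g : ptmap G G') :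
  bijective f -> bijective g -> bijective (smap f g).
Proof.
move=> [f' fK f'K] [g' gK g'K].
have f'_pt : f' point == point by apply/eqP; rewrite -(ptmap_pt f) fK.
have g'_pt : g' point == point by apply/eqP; rewrite -(ptmap_pt g) gK.
exists (smap (PtMap f'_pt) (PtMap g'_pt)) => p; rewrite -[p]spairK !smapE /=.
  by rewrite fK gK.
by rewrite f'K g'K.
Qed.

Section SmashLevel1.
Variables X Y : EndC.

(** The isomorphism of 1_+ /\ 1_+ with 1_+. *)
Let bump_fun (p : smash 'I_2 'I_2) : 'I_2 := if p == point then point else ord_max.
Let bump_pt : bump_fun point == point. Proof. by rewrite /bump_fun eqxx. Qed.
Let bump : ptmap (smash 'I_2 'I_2) 'I_2 := PtMap bump_pt.

Let D (p : smash (X 1%N) (Y 1%N)) : day X Y 1%N :=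
  \pi_(day X Y 1%N) (DayGen bump (val p).1 (val p).2).

Let D_pair x y : D (spair x y) = \pi_(day X Y 1%N) (DayGen bump x y).
Proof.
have pt (x' : X 1%N) (y' : Y 1%N) : x' = point \/ y' = point ->
    \pi_(day X Y 1%N) (DayGen bump x' y') = point.
  by move=> xy; apply/day_piP/rst_step; apply: day_collapse.
have [x0|x0] := eqVneq x point.
  by rewrite x0 spair_ptl (pt point y) ?/D ?pt //; left.
have [y0|y0] := eqVneq y point.
  by rewrite y0 spair_ptr (pt x point) ?/D ?pt //; [left|right].
by rewrite /D spairE.
Qed.

Let D_surj q : exists p, D p = q.
Proof.
rewrite -[q]reprK; case: (repr q) => m n f x y.
have [_ surjX _] := inC_crit (end_inC X); have [_ surjY _] := inC_crit (end_inC Y).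
have [i [u <-]] := surjX m x; have [j [v <-]] := surjY n y.
set d := \pi_ _ _.
have dE : d = \pi_(day X Y 1%N) (DayGen (ptcomp f (smap (kpick i) (kpick j))) u v).
  by apply/day_piP/rst_sym/rst_step; apply: day_move.
have val2 (a : 'I_2) : a != point -> a = ord_max.
  by move=> a0; apply: val_inj; case: a a0 => -[|[]].
have valf a b : ptcomp f (smap (kpick i) (kpick j)) (spair a b) =
   if spair a b == point then point else f (spair i j).
  have [->|a0] := eqVneq a point; first by rewrite spair_ptl eqxx ptmap_pt.
  have [->|b0] := eqVneq b point; first by rewrite spair_ptr eqxx ptmap_pt.
  have /negbTE -> : spair a b != point.
    by apply/eqP => /spair_eq_pt[] E; rewrite E eqxx in a0 b0.
  rewrite (val2 a a0) (val2 b b0).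
  exact: congr1 (smapE (kpick i) (kpick j) ord_max ord_max).
have [fij|fij] := eqVneq (f (spair i j)) point.
  exists point; have := D_pair point point; rewrite spair_ptl => ->; rewrite dE.
  have -> : ptcomp f (smap (kpick i) (kpick j)) = ptcomp (ptzero (smash 'I_1 'I_1) 'I_2)
     (smap (ptzero 'I_2 'I_1) (ptzero 'I_2 'I_1)).
    by apply: ptmapP => p; rewrite -[p]spairK valf fij if_same.
  apply/day_piP; apply: rst_trans (rst_step _ _ _ _ _) _.
    by apply: day_collapse; left.
  apply: rst_sym; apply: rst_trans (rst_step _ _ _ _ (day_move _ _ _ _ _)) _.
  by apply: rst_step; apply: day_collapse; left; apply: sob0.
exists (spair u v); rewrite D_pair dE; congr (\pi_ _ (DayGen _ _ _)).
apply: ptmapP => p; rewrite -[p]spairK valf /= /bump_fun.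
by case: eqP => // _; rewrite (val2 _ fij).
Qed.

(** The generators of the smash product at level 1 reduce to pairs of level-1
    elements, which gives a surjection from the smash product of the level-1
    sets. It is injective because the two sets have the same number of
    elements, by the description of the smash product of S /\ F1 and S /\ F2. *)
Lemma smash_level1 : exists2 h : ptmap (smash (X 1%N) (Y 1%N)) (end_smash X Y 1%N),
  bijective h & forall p, h (smap (end_T X 1%N) (end_T Y 1%N) p) =
                          end_T (end_smash X Y) 1%N (h p).
Proof.
have D_pt : D point == point.
  by apply/eqP/day_piP/rst_step; apply: day_collapse; left.
exists (@PtMap (smash (X 1%N) (Y 1%N)) (end_smash X Y 1%N) D D_pt); last first.
  move=> p; rewrite -[p]spairK smapE; move: (val p).1 (val p).2 => a b.
  rewrite [LHS]D_pair -[RHS]/(day_tens_fun (end_T X) (end_T Y) (D (spair a b))).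
  by rewrite D_pair day_tensE.
have [F1 [finF1 [phi1 phi1B]]] := end_inC X; have [F2 [finF2 [phi2 phi2B]]] := end_inC Y.
have [f1 f1B f1p] : exists2 f : X 1%N -> F1, bijective f & f point = point.
  by apply: level1_ssmash; exists phi1.
have [f2 f2B f2p] : exists2 f : Y 1%N -> F2, bijective f & f point = point.
  by apply: level1_ssmash; exists phi2.
have [g gB _] := level1_ssmash (sday_ssmash phi1B phi2B).
have [s' s'K sK'] := bij_smash (f := PtMap (introT eqP f1p)) (g := PtMap (introT eqP f2p)) f1B f2B.
apply: inj_surj_bij; last exact: D_surj.
apply: (@surj_equipotent_inj _ _ _ (s' \o g)).
- by apply: finite_smash; apply: finite_level1.
- exact: D_surj.
- apply: bij_comp gB; exact: (Bijective sK' s'K).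
Qed.

Lemma end_trace_smash n : end_trace (end_smash X Y) n = end_trace X n * end_trace Y n.
Proof.
have [h hB hT] := smash_level1; have [g hK gK] := hB.
have finS : finite_set [set: smash (X 1%N) (Y 1%N)].
  by apply: finite_smash; apply: finite_level1.
have [K [perX perY]] := common_period X Y.
have [L perL] := exists_period (end_T (end_smash X Y) 1%N) (finite_level1 _).
have perX' := is_period_mul perL.1 perX; have perY' := is_period_mul perL.1 perY.
have := is_period_mul perX.1 perL; rewrite mulnC => perS.
rewrite (end_traceE _ perX') (end_traceE _ perY') (end_traceE _ perS) -PoszM.
congr Posz; rewrite -scard_pfix_smash; try exact: finite_level1.
apply/esym/(scard_pfix_inj (h := h)) => //; first exact: bij_inj.
by move=> y _; exists (g y); rewrite gK.
Qed.

End SmashLevel1.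

Lemma end_trace_cycle l n K : (0 < l)%N -> (0 < K)%N -> (l %| K)%N ->
  end_trace (end_cycle l) n = ((l %| n K.-1) * l)%N%:Z.
Proof.
move=> l0 K0 lK; set T := end_T (end_cycle l) 1%N.
have iter_rot m (i : 'I_l) : iter m (rotation l) (Some i) =
    Some (Ordinal (ltn_pmod (i + m) l0)).
  elim: m => [|m /= ->]; first by congr Some; apply: val_inj; rewrite /= addn0 modn_small.
  by congr Some; apply: val_inj; rewrite /= -[in LHS]addn1 modnDml addn1 addnS.
have sB := smash2_bij (option 'I_l : pointedType).
pose h : ptmap (smash 'I_2 (option 'I_l)) (option 'I_l) :=
  @PtMap (smash 'I_2 (option 'I_l)) (option 'I_l) (fun p => (val p).2) (eqxx point).
have hT p : h (T p) = rotation l (h p) by apply: end_of_snd.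
have perK : is_period T K.
  split=> // p _; apply: (bij_inj sB).
  change (h (iter K T p) = h p).
  rewrite (iter_equivariant _ hT); case: (h p) => [i|].
    rewrite iter_rot; congr Some; apply: val_inj => /=.
    by have /dvdnP[q ->] := lK; rewrite addnC modnMDl modn_small.
  exact: iter_pt.
rewrite (end_traceE _ perK); congr Posz; set m := (_ + K)%N.
rewrite (scard_pfix_inj (h := h) (T := rotation l)) //; first last.
- by move=> y _; have [g _ gK] := sB; exists (g y); apply: gK.
- exact: bij_inj.
- exact: (finite_level1 (end_cycle l)).
have lm : (l %| m)%N = (l %| n K.-1)%N by rewrite dvdn_addl.
have iter_eq (i : 'I_l) : (iter m (rotation l) (Some i) == Some i) = (l %| n K.-1)%N.
  rewrite iter_rot -lm (inj_eq (@Some_inj _)) -val_eqE /=.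
  rewrite -[X in _ == X](modn_small (ltn_ord i)) -[X in _ == (X %% _)%N]addn0.
  by rewrite eqn_modDl mod0n.
have [ln|ln] := boolP (l %| n K.-1)%N; last first.
  rewrite mul0n /scard (_ : pfix _ _ = set0) ?fset_set0 ?cardfs0 //.
  apply/seteqP; split=> // -[i|] [] // _ /eqP; rewrite iter_eq.
  by rewrite (negbTE ln).
rewrite mul1n (_ : pfix _ _ = [set Some i | i in [set: 'I_l]]%classic); last first.
  apply/seteqP; split=> [[i|] [o0 oE]|_ [i _ <-]]; first by exists i.
    by rewrite eqxx in o0.
  by split=> //; apply/eqP; rewrite iter_eq.
rewrite scard_image; first last.
- by move=> i j _ _; apply: Some_inj.
- exact: finite_finset.
rewrite /scard -[RHS](card_ord l) -(card_finset (predT : pred 'I_l)).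
congr (#|` _|%fset); apply/fsetP => i.
rewrite in_fset_set ?in_fset /=; last exact: finite_finset.
by rewrite in_setT inE.
Qed.

Lemma end_trace_cycle0 n : end_trace (end_cycle 0) n = 0.
Proof.
have [K perK] := exists_period (end_T (end_cycle 0) 1%N) (finite_level1 _).
rewrite (end_traceE _ perK) /scard (_ : pfix _ _ = set0) ?fset_set0 ?cardfs0 //.
apply/seteqP; split=> // p [/eqP p0 _]; case: p0.
by apply: (bij_inj (smash2_bij (option 'I_0 : pointedType))); case: (val p).2 => [[]//|].
Qed.

(** * The universal additive invariant *)

(** The reduction to cycles also shows that additive invariants are determined
    by their values on cycles; the empty cycle is its own double, so its value
    is 0. *)
Lemma additive_invariant_ext (A : zmodType) (chi chi' : EndC -> A) :
  additive_invariant chi -> additive_invariant chi' ->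
  (forall l, (0 < l)%N -> chi (end_cycle l) = chi' (end_cycle l)) -> chi =1 chi'.
Proof.
have trivial0 (c : EndC -> A) : additive_invariant c -> c (end_cycle 0) = 0.
  move=> [c_iso _ c_add].
  have pt (x : end_cycle 0 1%N) : x = point.
    apply: (bij_inj (smash2_bij (option 'I_0 : pointedType))).
    by case: (val x).2 => [[]//|].
  have isoE (Y : EndC) : (forall y : Y 1%N, y = point) -> c (end_cycle 0) = c Y.
    move=> Ypt; apply: c_iso; apply: (@end_of_iso _ _ _ Y (ptzero _ _)) => [|x].
      apply: inj_surj_bij => [x y _|y]; last by exists point; rewrite [RHS]Ypt.
      by case: x y => [[]//|] [[]//|].
    by rewrite [RHS]Ypt.
  have : c (end_cycle 0) = c (end_wedge (end_cycle 0) (end_cycle 0)).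
    apply: isoE => -[[x y] /= p]; apply: val_inj; by rewrite /= (pt x) (pt y).
  by rewrite c_add => /eqP; rewrite -subr_eq0 opprD addrA subrr sub0r oppr_eq0 => /eqP.
move=> chiI chiI' chi_cycle; have [c_iso c_im c_add] := chiI; have [c_iso' c_im' c_add'] := chiI'.
apply: EndC_ind => [X Y XY|X|X Y|l].
- by rewrite (c_iso _ _ XY) (c_iso' _ _ XY).
- by rewrite -c_im -c_im'.
- by rewrite c_add c_add' => -> ->.
- by case: l => [|l]; [rewrite !trivial0|apply: chi_cycle].
Qed.

Lemma additive_invariant_comp (W A : zmodType) (f : {additive W -> A})
    (tau : EndC -> W) : additive_invariant tau -> additive_invariant (f \o tau).
Proof.
move=> [tau_iso tau_im tau_add]; split=> [X Y XY|X|X Y] /=.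
- by rewrite (tau_iso _ _ XY).
- by rewrite -tau_im.
- by rewrite tau_add raddfD.
Qed.

(** The target of a universal invariant is generated by its values, by the
    uniqueness part of the universal property. *)
Lemma universal_gen (W : zmodType) (tau : EndC -> W) (A : zmodType)
    (f g : {additive W -> A}) : universal_additive_invariant tau ->
  (forall X, f (tau X) = g (tau X)) -> f =1 g.
Proof.
move=> [tauI univ] fg.
have [k [_ kU]] := univ A _ (additive_invariant_comp g tauI).
by move=> w; rewrite (kU f fg) (kU g (fun=> erefl)).
Qed.

Section Fourier.
Variable R : realType.

Lemma fourier_cycle l n : fourier R (torsion_sum l) n = (end_trace (end_cycle l) n)%:~R.
Proof.
case: (posnP l) => [->|l0].
  by rewrite end_trace_cycle0 fourierE /torsion_sum big_ord0 raddf0.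
by rewrite (fourier_torsion_sum R n l0 (dvdnn l) l0) (end_trace_cycle n l0 l0 (dvdnn l)).
Qed.

Lemma fourier_trace_exists (X : EndC) :
  exists g : ZQZinv, forall n, fourier R (\val g) n = (end_trace X n)%:~R.
Proof.
apply: (EndC_ind (P := fun X => exists g : ZQZinv, forall n,
  fourier R (\val g) n = (end_trace X n)%:~R)) => {X} [X Y XY|X [g gE]|X Y [g gE] [h hE]|l].
- by split=> -[g gE]; exists g => n; rewrite gE (end_trace_iso n XY).
- by exists g => n; rewrite gE end_trace_image.
- exists (g + h) => n; rewrite end_trace_wedge intrD -gE -hE !fourierE.
  by rewrite rmorphD raddfD.
- by exists (torsion_inv l) => n; apply: fourier_cycle.
Qed.

(** The properties of tau are read off from those of traces, because the Fourier
    transform is injective. The invariant is universal because its values on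
    cycles form a basis of the invariants. *)
Lemma W0_exists : exists tau : EndC -> ZQZinv, is_W0 tau /\
  forall X n, fourier R (\val (tau X)) n = (end_trace X n)%:~R.
Proof.
have [tau tauE] := choice fourier_trace_exists.
have tau_eq X (g : ZQZinv) :
    (forall n, fourier R (\val g) n = (end_trace X n)%:~R) -> tau X = g.
  move=> gE; apply/val_inj/(@fourier_inj R) => n.
  by rewrite tauE gE.
have tau_cyc l : tau (end_cycle l) = torsion_inv l by apply: tau_eq => n; apply: fourier_cycle.
have tauI : additive_invariant tau.
  split=> [X Y XY|X|X Y]; apply: tau_eq => n.
  - by rewrite tauE (end_trace_iso n XY).
  - by rewrite tauE end_trace_image.
  - by rewrite end_trace_wedge intrD -!tauE !fourierE rmorphD raddfD.
exists tau; split=> //; split; last first.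
  by move=> X Y; apply: tau_eq => n; rewrite end_trace_smash intrM -!tauE rmorphM fourierM.
split=> // A chi chiI.
have [f fE] := ZQZinv_ext (fun l => chi (end_cycle l)).
exists f; split=> [X|g gE].
  apply: (additive_invariant_ext (additive_invariant_comp f tauI) chiI).
  by move=> l l0 /=; rewrite tau_cyc fE.
by apply: ZQZinv_gen => l l0; rewrite fE // -tau_cyc gE.
Qed.
End Fourier.

Theorem theorem2p3 (R : realType) :
  (exists (W : comPzRingType) (tau : EndC -> W), is_W0 tau) /\
  forall (W : comPzRingType) (tau : EndC -> W), is_W0 tau ->
    exists phi : {rmorphism W -> ZQZinv},
      [/\ bijective phi,
          forall (X : EndC) (n : Zhat),
            fourier R (phi (tau X)) n = (end_trace X n)%:~R,
          forall tau' : EndC -> groupring QZ,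
            (forall (X : EndC) (n : Zhat),
              fourier R (tau' X) n = (end_trace X n)%:~R) ->
            forall X : EndC, tau' X = phi (tau X)
        & forall psi : {rmorphism W -> ZQZinv},
            (forall (X : EndC) (n : Zhat),
              fourier R (psi (tau X)) n = (end_trace X n)%:~R) ->
            psi =1 phi].
Proof.
have [tau0 [W0 tau0E]] := W0_exists R; split; first by exists ZQZinv, tau0.
move=> W tau W1; have [univ0 mul0] := W0; have [univ1 mul1] := W1.
have [f [fE _]] := univ1.2 _ _ univ0.1; have [g [gE _]] := univ0.2 _ _ univ1.1.
have gK : cancel f g.
  apply: (universal_gen (f := g \o f) (g := idfun) univ1) => X /=.
  by rewrite fE gE.
have fK : cancel g f.
  apply: (universal_gen (f := f \o g) (g := idfun) univ0) => X /=.
  by rewrite gE fE.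
(* It is enough to check products of generators, one factor at a time. *)
have fM : {morph f : v w / v * w}.
  move=> v w; apply: (universal_gen (f := f \o (w \o* idfun)) (g := f w \o* f) univ1 _ v).
  move=> X /=; apply: (universal_gen (f := f \o (tau X \*o idfun))
    (g := f (tau X) \*o f) univ1 _ w) => Y /=.
  by rewrite -mul1 !fE mul0.
(* A surjective multiplicative map preserves the unit. *)
have f1 : f 1 = 1 by rewrite -[LHS]mulr1 -[1 in X in _ * X]fK -fM mul1r fK.
have fMon : monoid_morphism f by [].
pose fA := GRing.isZmodMorphism.Build W ZQZinv f (raddfB f).
pose fMul := GRing.isMonoidMorphism.Build W ZQZinv f fMon.
pose phi : {rmorphism W -> ZQZinv} := HB.pack (f : W -> ZQZinv) fA fMul.
have phiE X : phi (tau X) = tau0 X by apply: fE.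
exists phi; split.
- by exists g.
- by move=> X n; rewrite phiE tau0E.
- by move=> tau' tau'E X; rewrite phiE; apply: (@fourier_inj R) => n; rewrite tau'E tau0E.
- move=> psi psiE; apply: (universal_gen univ1) => X; apply/esym; rewrite [LHS]fE.
  by apply/val_inj/(@fourier_inj R) => n; rewrite tau0E psiE.
Qed.
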